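(* Consider the finite-sum problem $\min_{\omega\in\mathbb{R}^d}F(\omega)$ and the SODDA algorithm described in the context. Suppose: (2) $F$ is strongly convex with parameter $\xi>0$; (3) there is $L\ge 1$ such that $\|\nabla f_i(x_i\omega)-\nabla f_i(x_i\hat\omega)\|\le L\|\omega-\hat\omega\|$ for all $\omega,\hat\omega\in\mathbb{R}^d$ and all $i$; (4) there is a constant $G$ such that $\frac{1}{N-1}\sum_{j=1}^N\left(\|\nabla f_j(x_j\omega^t)\|^2-\|\nabla F(\omega^t)\|^2\right)\le G^2$ for all iterates $\omega^t$; (5) there is a constant $M_2$ such that $\|\omega^t\|\le\frac{M_2}{2}$ for all $t$, and also $\|\omega^*\|\le\frac{M_2}2$. Suppose the learning rate is constant, $\gamma_t=\gamma$, with $BL\gamma QP\le1$ (which implies $\gamma\le1$), and for some constant $\eta\ge0$ and all $t\ge0$ $$b_t\in\left[\max\left\{c_t,\ \frac{d}{1+\frac{4d\eta\gamma^2}{c_tM_2^2L^2}}\right\},\ d\right],\qquad c_t\le d,\qquad s_t\le N.$$ Then there exists a positive constant $C_4$ such that $$\liminf_{t\to\infty}F(\omega^t)-F(\omega^* )\le\frac{C_4dB^3\gamma}{2\xi}\quad\text{a.s.}$$ Moreover, if $\gamma<\min\left\{\frac{d}{2\xi B},\frac1{BLQP},1\right\}$, then for all $t$ $$\mathbb{E}\left[F(\omega^t)-F(\omega^* )\right]\le\left(1-\frac{2\xi B}{d}\gamma\right)^t\left(F(\omega^0)-F(\omega^* )\right)+\frac{C_4dB^3\gamma}{2\xi}.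$$
   Context: Problem. $N,d,P,Q$ are positive integers with $P\mid N$ and $QP\mid d$; put $n=N/P$, $\tilde m=d/(QP)$. Data: row vectors $x_i$ with $x_i^T\in\mathbb{R}^d$, and differentiable functions $f_i:\mathbb{R}\to\mathbb{R}$ ($f_i=\bar f(\cdot,y_i)$ for a loss $\bar f$ and label $y_i$), $i=1,\dots,N$. $F(\omega)=\frac1N\sum_{i=1}^N f_i(x_i\omega)$. $\nabla f_i(x_i\omega)\in\mathbb{R}^d$ denotes the gradient with respect to $\omega$ of $\omega\mapsto f_i(x_i\omega)$. Norms are Euclidean. It is assumed throughout that $F$ has a unique minimizer $\omega^*$. Partitioning. The $N$ observations are split into $P$ partitions of $n$ observations each; the $d$ features are split into $Q$ blocks, each further split into $P$ sub-blocks of size $\tilde m$. Accordingly $\omega=(\omega_{1,1},\dots,\omega_{1,P},\omega_{2,1},\dots,\omega_{Q,P})$ with $\omega_{q,k}\in\mathbb{R}^{\tilde m}$. For $p,k\in\{1,\dots,P\}$, $q\in\{1,\dots,Q\}$, $j\in\{1,\dots,n\}$, $x_j^{p,q,k}$ is the restriction of the $j$-th observation of observation partition $p$ to feature sub-block $(q,k)$, and $f_j^p$ is the function $f_i$ of that observation. $\nabla_{\omega_{q,k}}f_j^p(x_j^{p,q,k}\omega_{q,k})\in\mathbb{R}^{\tilde m}$ is the gradient of $\omega_{q,k}\mapsto f_j^p(x_j^{p,q,k}\omega_{q,k})$ (only the local sub-block enters the inner product). SODDA. Inputs: integer $B\ge1$ (batch size), positive learning rates $(\gamma_t)_{t\ge1}$,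 integers $1\le c_t\le b_t\le d$, $1\le s_t\le N$ for $t\ge0$. Start with $\omega^0=0$. For $t=0,1,2,\dots$: - sample $\mathcal B_t\subseteq\{1,\dots,d\}$ of size $b_t$ uniformly without replacement; sample $\mathcal C_t\subseteq\mathcal B_t$ of size $c_t$ uniformly without replacement; sample $\mathcal D_t\subseteq\{1,\dots,N\}$ of size $s_t$ uniformly without replacement; - let $\mu^t=\frac1{s_t}\sum_{j\in\mathcal D_t}g_j$, where $g_j\in\mathbb{R}^d$ has $k$-th coordinate $f_j'\big(\sum_{l\in\mathcal B_t}(x_j)_l\,\omega^t_l\big)(x_j)_k$ if $k\in\mathcal C_t$ and $0$ otherwise; - for each $q$, select a (random) bijection $\pi_q$ of $\{1,\dots,P\}$; - for all $p,q$ in parallel, with $k=\pi_q(p)$: set $\bar\omega^{(0)}_{q,k}=\omega^t_{q,k}$, and for $i=0,\dots,B-1$ pick $j\in\{1,\dots,n\}$ uniformly at random (freshly for each $p,q,i$) and set $$\bar\omega^{(i+1)}_{q,k}=\bar\omega^{(i)}_{q,k}-\gamma_{t+1}\Big[\nabla_{\omega_{q,k}}f_j^p(x_j^{p,q,k}\bar\omega^{(i)}_{q,k})-\nabla_{\omega_{q,k}}f_j^p(x_j^{p,q,k}\omega^t_{q,k})+\mu^t_{q,k}\Big],$$ where $\mu^t_{q,k}$ is the $(q,k)$ sub-block of $\mu^t$; - $\omega^{t+1}$ is the concatenation of all $\bar\omega^{(B)}_{q,k}$. All random choices are made independently of the past and of each other, except that $\mathcal C_t$ is drawn from $\mathcal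 B_t$. *)

(* Defs.v *)
From HB Require Import structures.
From mathcomp Require Import all_boot all_order all_algebra perm.
From mathcomp Require Import all_classical all_reals all_analysis.

Set Implicit Arguments.
Unset Strict Implicit.
Unset Printing Implicit Defensive.

Import Order.TTheory GRing.Theory Num.Theory.
Import numFieldNormedType.Exports.

Local Open Scope classical_set_scope.
Local Open Scope ring_scope.

(* The norm [`|v|] that the library puts on matrices is the maximum norm. *)
Definition enorm (R : realType) (d : nat) (v : 'cV[R]_d) : R :=
  Num.sqrt (\sum_k v k 0 ^+ 2).

Definition gradient (R : realType) (d : nat) (g : 'cV[R]_d -> R)
    (w : 'cV[R]_d) : 'cV[R]_d :=
  \col_k 'D_(delta_mx k 0) g w.

Definition strongly_convex (R : realType) (d : nat) (xi : R)
    (g : 'cV[R]_d -> R) : Prop :=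
  forall (v w : 'cV[R]_d) (t : R), 0 <= t <= 1 ->
    g (t *: v + (1 - t) *: w) <=
      t * g v + (1 - t) * g w - xi / 2 * t * (1 - t) * enorm (v - w) ^+ 2.

Definition unique_minimizer (R : realType) (d : nat) (g : 'cV[R]_d -> R)
    (w : 'cV[R]_d) : Prop :=
  (forall v, g w <= g v) /\ (forall v, (forall u, g v <= g u) -> v = w).

Definition loss (R : realType) (d : nat) (x : 'rV[R]_d) (f : R -> R)
    (w : 'cV[R]_d) : R :=
  f ((x *m w) 0 0).

Definition risk (R : realType) (N d : nat) (x : 'I_N -> 'rV[R]_d)
    (f : 'I_N -> R -> R) (w : 'cV[R]_d) : R :=
  N%:R^-1 * \sum_i loss (x i) (f i) w.

Lemma feat_subproof (d Q P : nat) (q : 'I_Q) (k : 'I_P)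
    (l : 'I_(d %/ (Q * P))) : ((q * P + k) * (d %/ (Q * P)) + l < d)%N.
Proof.
have qk : (q * P + k < Q * P)%N.
  apply: (@leq_trans (q.+1 * P)%N); last by rewrite leq_mul2r ltn_ord orbT.
  by rewrite mulSn addnC ltn_add2r.
apply: (@leq_trans ((q * P + k).+1 * (d %/ (Q * P)))%N).
  by rewrite mulSn addnC ltn_add2r.
apply: leq_trans (leq_divM d (Q * P)).
by rewrite mulnC leq_mul2l qk orbT.
Qed.

(* Position in 'I_d of the l-th feature of the sub-block (q, k): the
   sub-blocks are contiguous and ordered (1,1), ..., (1,P), (2,1), ..., (Q,P).
   When Q * P divides d this is a bijection from the triples (q, k, l). *)
Definition feat (d Q P : nat) (q : 'I_Q) (k : 'I_P)
    (l : 'I_(d %/ (Q * P))) : 'I_d :=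
  Ordinal (feat_subproof q k l).

(* All the random choices of one outer iteration; [pick p q i] is the index
   of the observation of partition p used at inner step i by the processor
   in charge of partition p and block q. *)
Record draw (N d P Q B : nat) := Draw {
  feature_set : {set 'I_d};
  coordinate_set : {set 'I_d};
  observation_set : {set 'I_N};
  assignment : 'I_Q -> {perm 'I_P};
  pick : 'I_P -> 'I_Q -> 'I_B -> 'I_(N %/ P)
}.

Definition estimated_gradient (R : realType) (N d : nat)
    (x : 'I_N -> 'rV[R]_d) (f : 'I_N -> R -> R) (s : nat)
    (Bt Ct : {set 'I_d}) (Dt : {set 'I_N}) (w : 'cV[R]_d) : 'cV[R]_d :=
  s%:R^-1 *: \sum_(j in Dt) \col_k
    (if k \in Ct then derive1 (f j) (\sum_(l in Bt) x j 0 l * w l 0) * x j 0 k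
     else 0).

(* [obs (p, j)] is the j-th observation of partition p. *)
Definition inner_loop (R : realType) (N d P Q B : nat)
    (x : 'I_N -> 'rV[R]_d) (f : 'I_N -> R -> R)
    (obs : 'I_P * 'I_(N %/ P) -> 'I_N) (gamma : R) (mu w : 'cV[R]_d)
    (p : 'I_P) (q : 'I_Q) (k : 'I_P) (js : 'I_B -> 'I_(N %/ P)) :
    'cV[R]_(d %/ (Q * P)) :=
  let local_gradient j := gradient
    (loss (colsub (feat q k) (x (obs (p, j)))) (f (obs (p, j)))) in
  let w0 := rowsub (feat q k) w in
  foldl (fun v i => v - gamma *:
      (local_gradient (js i) v - local_gradient (js i) w0
       + rowsub (feat q k) mu))
    w0 (enum 'I_B).

(* When Q * P divides d, every coordinate a is [feat q (assignment u q p) l]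
   for exactly one triple (q, p, l), so the sum has a single term and
   concatenates the results of the processors. *)
Definition sodda_step (R : realType) (N d P Q B : nat)
    (x : 'I_N -> 'rV[R]_d) (f : 'I_N -> R -> R)
    (obs : 'I_P * 'I_(N %/ P) -> 'I_N) (gamma : R) (s : nat)
    (u : draw N d P Q B) (w : 'cV[R]_d) : 'cV[R]_d :=
  let mu := estimated_gradient x f s
    (feature_set u) (coordinate_set u) (observation_set u) w in
  \col_a \sum_(q < Q) \sum_(p < P)
    \sum_(l | feat q (assignment u q p) l == a)
      inner_loop x f obs gamma mu w p q (assignment u q p) (pick u p q) l 0.

Fixpoint sodda (R : realType) (N d P Q B : nat)
    (x : 'I_N -> 'rV[R]_d) (f : 'I_N -> R -> R)
    (obs : 'I_P * 'I_(N %/ P) -> 'I_N) (gamma : nat -> R) (s : nat -> nat)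
    (u : nat -> draw N d P Q B) (t : nat) : 'cV[R]_d :=
  if t is t'.+1 then
    sodda_step x f obs (gamma t) (s t') (u t') (sodda x f obs gamma s u t')
  else 0.

(* Independence of a family of classes of events: the product rule for every
   finite choice of distinct indices. *)
Definition mutually_independent (R : realType) (disp : measure_display)
    (T : measurableType disp) (Pr : probability T R) (I : Type)
    (E : I -> set (set T)) : Prop :=
  forall (n : nat) (a : 'I_n -> I) (A : 'I_n -> set T), injective a ->
    (forall i, E (a i) (A i)) ->
    Pr (\bigcap_i A i) = (\prod_i Pr (A i))%E.

(* Every set of values is allowed, since the random variables below take
   values in finite types. *)
Definition generated_events (T V : Type) (X : T -> V) : set (set T) :=
  [set X @^-1` A | A in setT].

Definition uniformly_distributed (R : realType) (disp : measure_display)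
    (T : measurableType disp) (Pr : probability T R) (V : finType)
    (X : T -> V) (A : {set V}) : Prop :=
  forall v, Pr (X @^-1` [set v]) = (if v \in A then #|A|%:R^-1 else 0)%:E.

(* The independent sources of randomness. The feature set and the coordinate
   set drawn from it form a single source. *)
Inductive source (P Q B : nat) :=
  | Features of nat
  | Observations of nat
  | Assignment of nat & 'I_Q
  | Pick of nat & 'I_P & 'I_Q & 'I_B.

Definition source_events (T : Type) (N d P Q B : nat)
    (U : nat -> T -> draw N d P Q B) (a : source P Q B) : set (set T) :=
  match a with
  | Features t => generated_events
      (fun o => (feature_set (U t o), coordinate_set (U t o)))
  | Observations t => generated_events (fun o => observation_set (U t o))
  | Assignment t q => generated_events (fun o => assignment (U t o) q)
  | Pick t p q i => generated_events (fun o => pick (U t o) p q i)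
  end.

(* No law is prescribed for the bijections [assignment (U t o) q]. *)
Record sodda_sampling (R : realType) (disp : measure_display)
    (T : measurableType disp) (Pr : probability T R) (N d P Q B : nat)
    (b c s : nat -> nat) (U : nat -> T -> draw N d P Q B) : Prop := {
  sampling_measurable : forall a, source_events U a `<=` measurable;
  sampling_independent : mutually_independent Pr (source_events U);
  sampling_features : forall t,
    uniformly_distributed Pr (fun o => feature_set (U t o))
      [set S : {set 'I_d} | #|S| == b t]%SET;
  sampling_coordinates : forall t (S S' : {set 'I_d}),
    let subsets := [set C : {set 'I_d} | (C \subset S) && (#|C| == c t)]%SET in
    (Pr [set o | feature_set (U t o) = S /\ coordinate_set (U t o) = S'] =
     Pr [set o | feature_set (U t o) = S] *
       (if S' \in subsets then #|subsets|%:R^-1 else 0)%:E)%E;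
  sampling_observations : forall t,
    uniformly_distributed Pr (fun o => observation_set (U t o))
      [set S : {set 'I_N} | #|S| == s t]%SET;
  sampling_picks : forall t p q i,
    uniformly_distributed Pr (fun o => pick (U t o) p q i) [set: 'I_(N %/ P)]%SET
}.

(* Main.v *)
Require Import Defs.
From HB Require Import structures.
From mathcomp Require Import all_boot all_order all_algebra perm.
From mathcomp Require Import all_classical all_reals all_analysis.
From mathcomp Require Import ring lra.

Set Implicit Arguments.
Unset Strict Implicit.
Unset Printing Implicit Defensive.

Import Order.TTheory GRing.Theory Num.Theory.
Import numFieldNormedType.Exports.

Local Open Scope classical_set_scope.
Local Open Scope ring_scope.

(* With [D = w_{t+1} - w_t] and [mu] the gradient estimate of the outer
   iteration, the inner loops of variance-reduced steps only drift by
   [O(gamma B |mu|)], so [D = - gamma B mu + O(gamma^2 B^2)] whatever the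
   bijections and the picked observations are.  Smoothness of the risk then
   gives [F w_{t+1} <= F w_t - gamma B <grad F w_t, mu> + O(gamma^2 B^2)].
   Averaging over the three random sets, which are independent of the past,
   turns [<grad F, mu>] into [(c / d) |grad F|^2] up to the error due to masking
   the features outside the feature set, and the lower bound on [b] makes this
   error [O(gamma)].  As [c >= 1], the Polyak-Lojasiewicz inequality yields
   [E (F w_{t+1} - F ws | past) <= (1 - 2 xi B gamma / d) (F w_t - F ws) + rho]
   with [rho = O(gamma^2 B^2)].  Iterating gives the bound in expectation.  If
   the gap stayed above its limit plus [e] from some time on with positive
   probability, its expectation restricted to that event would decrease
   linearly and become negative, whence the almost sure bound.

   All random variables take finitely many values, so that expectations are
   finite sums and conditioning on the past is a sum over histories. *)

(** * Euclidean norm, smoothness and strong convexity *)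

Definition dotv (R : realType) (d : nat) (u v : 'cV[R]_d) : R :=
  \sum_k u k 0 * v k 0.

Section Euclidean.
Context (R : realType) (d : nat).
Implicit Types (u v w : 'cV[R]_d) (a : R).

Lemma dotvC u v : dotv u v = dotv v u.
Proof. by apply: eq_bigr => k _; rewrite mulrC. Qed.

Lemma dotvDl u v w : dotv (u + v) w = dotv u w + dotv v w.
Proof. by rewrite -big_split; apply: eq_bigr => k _; rewrite mxE mulrDl. Qed.

Lemma dotvZl a u v : dotv (a *: u) v = a * dotv u v.
Proof. by rewrite mulr_sumr; apply: eq_bigr => k _; rewrite mxE mulrA. Qed.

Lemma dotvDr u v w : dotv u (v + w) = dotv u v + dotv u w.
Proof. by rewrite dotvC dotvDl !(dotvC u). Qed.

Lemma dotvZr a u v : dotv u (a *: v) = a * dotv u v.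
Proof. by rewrite dotvC dotvZl dotvC. Qed.

Lemma dotv_sumr I (r : seq I) (P : pred I) u (F : I -> 'cV[R]_d) :
  dotv u (\sum_(i <- r | P i) F i) = \sum_(i <- r | P i) dotv u (F i).
Proof.
rewrite /dotv exchange_big; apply: eq_bigr => k _ /=.
by rewrite summxE mulr_sumr.
Qed.

Lemma enorm_ge0 v : 0 <= enorm v.
Proof. exact: sqrtr_ge0. Qed.

Lemma enorm_sqr v : enorm v ^+ 2 = \sum_k v k 0 ^+ 2.
Proof. by rewrite sqr_sqrtr// sumr_ge0// => k _; exact: sqr_ge0. Qed.

Lemma dotvv v : dotv v v = enorm v ^+ 2.
Proof. by rewrite enorm_sqr; apply: eq_bigr => k _; rewrite expr2. Qed.

Lemma enorm0 : enorm (0 : 'cV[R]_d) = 0.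
Proof.
by rewrite /enorm big1 ?sqrtr0// => k _; rewrite mxE expr0n.
Qed.

Lemma enorm_eq0 v : enorm v = 0 -> v = 0.
Proof.
move=> v0; apply/colP => k; rewrite mxE; apply/eqP.
have := enorm_sqr v; rewrite v0 expr0n/= => /esym/eqP.
rewrite psumr_eq0 => [/allP/(_ k (mem_index_enum _))|i _]; last exact: sqr_ge0.
by rewrite sqrf_eq0.
Qed.

(** Cauchy-Schwarz. The squared norm of |v| u - |u| v is 2 |u| |v| times the difference of the two
    sides, so zero vectors are treated apart. *)
Lemma dotv_le u v : dotv u v <= enorm u * enorm v.
Proof.
have [u0|] := eqVneq (enorm u) 0.
  rewrite u0 mul0r (enorm_eq0 u0) /dotv big1// => k _.
  by rewrite mxE mul0r.
have [v0|v0 u0] := eqVneq (enorm v) 0.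
  rewrite v0 mulr0 (enorm_eq0 v0) /dotv big1// => k _.
  by rewrite mxE mulr0.
have up : 0 < enorm u by rewrite lt_def u0 enorm_ge0.
have vp : 0 < enorm v by rewrite lt_def v0 enorm_ge0.
have := sqr_ge0 (enorm (enorm v *: u + (- enorm u) *: v)).
rewrite -dotvv !(dotvDl, dotvDr, dotvZl, dotvZr) !dotvv (dotvC v u).
set a := enorm u; set b := enorm v; set c := dotv u v => h.
have ab : 0 < a * b by rewrite mulr_gt0.
rewrite -subr_ge0 -(pmulr_rge0 _ ab).
nra.
Qed.

Lemma enorm_triangle u v : enorm (u + v) <= enorm u + enorm v.
Proof.
rewrite -(@ler_pXn2r _ 2) ?nnegrE ?addr_ge0 ?enorm_ge0//.
rewrite -dotvv !(dotvDl, dotvDr) !dotvv (dotvC v u) sqrrD.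
have := dotv_le u v; lra.
Qed.

Lemma enormZ a v : enorm (a *: v) = `|a| * enorm v.
Proof.
rewrite -[`|a|]sqrtr_sqr /enorm -sqrtrM ?sqr_ge0// mulr_sumr.
by congr Num.sqrt; apply: eq_bigr => k _; rewrite mxE exprMn.
Qed.

Lemma enormN v : enorm (- v) = enorm v.
Proof. by rewrite -scaleN1r enormZ normrN1 mul1r. Qed.

Lemma enorm_le_sqr v a : 0 <= a -> enorm v ^+ 2 <= a ^+ 2 -> enorm v <= a.
Proof. by move=> a0; rewrite ler_pXn2r// nnegrE enorm_ge0. Qed.

Lemma enorm_sum I (r : seq I) (P : pred I) (F : I -> 'cV[R]_d) :
  enorm (\sum_(i <- r | P i) F i) <= \sum_(i <- r | P i) enorm (F i).
Proof.
elim/big_ind2 : _ => [|u a v b ua vb|//]; first by rewrite enorm0.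
exact: le_trans (enorm_triangle _ _) (lerD ua vb).
Qed.

End Euclidean.

(** * Differentiation and smoothness of the losses and of the risk *)

Section Loss.
Context (R : realType).

Lemma is_derive_affine (f : R -> R) (a b h : R) :
  (forall z, derivable f z 1) ->
  is_derive h 1 (fun s => f (a + s * b)) (derive1 f (a + h * b) * b).
Proof.
move=> df.
have dl : is_derive h (1 : R) (fun s : R => a + s * b) b.
  rewrite (_ : (fun s => _) = cst a + b *: id); last first.
    by apply/funext => s; rewrite !fctE mulrC.
  by apply: is_derive_eq; rewrite add0r [LHS]mulr1.
have := @is_derive1_comp R f (fun s : R => a + s * b) h _ _ _ dl.
apply; apply: DeriveDef => //.
by rewrite derive1E.
Qed.

(** Both difference quotients are the same function, which reduces directional derivatives to
    one-variable calculus. *)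
Lemma is_derive_line d (g : 'cV[R]_d -> R) (w v : 'cV[R]_d) (l : R) :
  is_derive (0 : R) 1 (fun s => g (w + s *: v)) l -> is_derive w v g l.
Proof.
have E : (fun h : R => h^-1 *: ((g \o shift w) (h *: v) - g w)) =
  (fun h : R => h^-1 *: (((fun s : R => g (w + s *: v)) \o shift 0) (h *: 1)
     - g (w + 0 *: v))).
  apply/funext => h /=; rewrite scale0r addr0.
  by rewrite [h *: 1]mulr1 addr0 [_ + w]addrC.
move=> [dg gl]; split; last by rewrite -gl /derive E.
by move: dg; rewrite /derivable E.
Qed.

Lemma row_mul_line d (x : 'rV[R]_d) (w v : 'cV[R]_d) (s : R) :
  (x *m (w + s *: v)) 0 0 = (x *m w) 0 0 + s * (x *m v) 0 0.
Proof. by rewrite mulmxDr -scalemxAr !mxE. Qed.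

Lemma is_derive_loss_line d (x : 'rV[R]_d) (f : R -> R) (w v : 'cV[R]_d)
    (h : R) : (forall z, derivable f z 1) ->
  is_derive h 1 (fun s => loss x f (w + s *: v))
    (derive1 f ((x *m (w + h *: v)) 0 0) * (x *m v) 0 0).
Proof.
move=> df; rewrite row_mul_line.
rewrite (_ : (fun s => _) =
  fun s : R => f ((x *m w) 0 0 + s * (x *m v) 0 0)); last first.
  by apply/funext => s; rewrite /loss row_mul_line.
exact: is_derive_affine.
Qed.

Lemma mul_delta_col d (x : 'rV[R]_d) k :
  (x *m (delta_mx k 0 : 'cV[R]_d)) 0 0 = x 0 k.
Proof. by rewrite -colE mxE. Qed.

Lemma gradient_loss d (x : 'rV[R]_d) (f : R -> R) (w : 'cV[R]_d) :
  (forall z, derivable f z 1) ->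
  gradient (loss x f) w = derive1 f ((x *m w) 0 0) *: x^T.
Proof.
move=> df; apply/colP => k; rewrite !mxE.
have /is_derive_line /@derive_val -> :=
  @is_derive_loss_line d x f w (delta_mx k 0) 0 df.
by rewrite scale0r addr0 mul_delta_col mxE.
Qed.

Section Risk.
Context (N d : nat) (x : 'I_N -> 'rV[R]_d) (f : 'I_N -> R -> R).
Hypothesis df : forall i z, derivable (f i) z 1.

Lemma is_derive_risk_line (w v : 'cV[R]_d) (h : R) :
  is_derive h 1 (fun s => risk x f (w + s *: v))
    (N%:R^-1 * \sum_i
       derive1 (f i) ((x i *m (w + h *: v)) 0 0) * (x i *m v) 0 0).
Proof.
rewrite (_ : (fun s => _) =
  N%:R^-1 *: \sum_i (fun s => loss (x i) (f i) (w + s *: v))); last first.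
  by apply/funext => s; rewrite !fctE fct_sumE.
apply: is_deriveZ; apply: is_derive_sum => i.
exact: is_derive_loss_line.
Qed.

Lemma gradient_risk (w : 'cV[R]_d) :
  gradient (risk x f) w = N%:R^-1 *: \sum_i gradient (loss (x i) (f i)) w.
Proof.
apply/colP => k; rewrite !mxE.
have /is_derive_line /@derive_val -> := is_derive_risk_line w (delta_mx k 0) 0.
rewrite scale0r addr0 summxE; congr (_ * _); apply: eq_bigr => i _.
by rewrite gradient_loss// mul_delta_col [RHS]mxE [(x i)^T k 0]mxE.
Qed.

Lemma dotv_gradient_risk (w v : 'cV[R]_d) :
  dotv (gradient (risk x f) w) v =
  N%:R^-1 * \sum_i derive1 (f i) ((x i *m w) 0 0) * (x i *m v) 0 0.
Proof.
rewrite gradient_risk dotvZl dotvC dotv_sumr; congr (_ * _).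
apply: eq_bigr => i _; rewrite gradient_loss// dotvZr; congr (_ * _).
by rewrite /dotv mxE; apply: eq_bigr => k _; rewrite mxE mulrC.
Qed.

Variable L : R.
Hypothesis lipL : forall i v v',
  enorm (gradient (loss (x i) (f i)) v - gradient (loss (x i) (f i)) v')
    <= L * enorm (v - v').
Hypothesis L0 : 0 < L.

Lemma gradient_risk_lipschitz (v v' : 'cV[R]_d) : (0 < N)%N ->
  enorm (gradient (risk x f) v - gradient (risk x f) v') <= L * enorm (v - v').
Proof.
move=> N0; rewrite !gradient_risk -scalerBr -sumrB enormZ.
rewrite ger0_norm ?invr_ge0// ler_pdivrMl ?ltr0n//.
apply: (le_trans (enorm_sum _ _ _)).
apply: (le_trans (ler_sum _ (fun i _ => lipL i v v'))).
by rewrite sumr_const card_ord mulr_natl.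
Qed.

(* The mean value theorem gives the quadratic term with constant [L] instead
   of the optimal [L / 2], in both directions at once. *)
Lemma risk_smooth (w v : 'cV[R]_d) : (0 < N)%N ->
  `|risk x f (w + v) - risk x f w - dotv (gradient (risk x f) w) v|
    <= L * enorm v ^+ 2.
Proof.
move=> N0.
pose phi s := risk x f (w + s *: v).
pose dphi s := dotv (gradient (risk x f) (w + s *: v)) v.
have dp (s : R) : is_derive s 1 phi (dphi s).
  by rewrite /dphi dotv_gradient_risk; exact: is_derive_risk_line.
have [|c c01] := @MVT R phi dphi 0 1 ltr01 (fun s _ => dp s).
  apply: continuous_subspaceT => s.
  by apply/differentiable_continuous/derivable1_diffP; case: (dp s).
rewrite /phi scale1r scale0r addr0 subr0 mulr1 => ->.
rewrite /dphi -[- dotv _ v]mulN1r -dotvZl -dotvDl scaleN1r.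
have bnd u : dotv (gradient (risk x f) (w + c *: v) - gradient (risk x f) w) u
    <= L * enorm v * enorm u.
  apply: (le_trans (dotv_le _ _)); rewrite ler_wpM2r ?enorm_ge0//.
  apply: (le_trans (gradient_risk_lipschitz _ _ N0)).
  rewrite addrAC subrr add0r enormZ ler_wpM2l ?(ltW L0)//.
  rewrite ler_piMl ?enorm_ge0// ger0_norm.
    by move: c01; rewrite in_itv/= => /andP[_ /ltW].
  by move: c01; rewrite in_itv/= => /andP[/ltW].
rewrite ler_norml expr2 mulrA bnd andbT lerNl -mulN1r -dotvZr.
by apply: (le_trans (bnd _)); rewrite scaleN1r enormN.
Qed.

(** Moving from [ws] by - g / (2 L) gains |g|^2 / (2 L) to first order and loses at most |g|^2 / (4
    L), so a nonzero gradient g would contradict minimality. *)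
Lemma gradient_minimizer ws : (0 < N)%N ->
  (forall v, risk x f ws <= risk x f v) -> gradient (risk x f) ws = 0.
Proof.
move=> N0 mins; apply: enorm_eq0.
set g := gradient _ ws.
have := risk_smooth ws (- (2 * L)^-1 *: g) N0; rewrite -/g => /ler_normlP[_].
have := mins (ws + - (2 * L)^-1 *: g).
rewrite dotvZr dotvv enormZ normrN ger0_norm ?invr_ge0 ?mulr_ge0 ?(ltW L0)//.
set a := risk _ _ _; set b := risk _ _ _ => ab.
rewrite exprMn => h.
have E : L * ((2 * L)^-1 ^+ 2 * enorm g ^+ 2) =
  (2 * L)^-1 * enorm g ^+ 2 / 2 by field; rewrite lt0r_neq0.
rewrite E in h.
have p : 0 < (2 * L)^-1 by rewrite invr_gt0 mulr_gt0.
have : (2 * L)^-1 * enorm g ^+ 2 <= 0 by lra.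
by rewrite pmulr_rle0// => q; apply/eqP; rewrite -sqrf_eq0 eq_le q sqr_ge0.
Qed.

Lemma gradient_risk_le (ws w : 'cV[R]_d) : (0 < N)%N ->
  (forall v, risk x f ws <= risk x f v) ->
  enorm (gradient (risk x f) w) <= L * enorm (w - ws).
Proof.
move=> N0 mins; have := gradient_risk_lipschitz w ws N0.
by rewrite (gradient_minimizer N0 mins) subr0.
Qed.

(** Convexity and smoothness along w + t (v - w), divided by t, give the inequality up to an error
    O(t). Instead of a limit, one well-chosen t gives a contradiction. *)
Lemma strongly_convex_gradient xi (w v : 'cV[R]_d) : (0 < N)%N ->
  strongly_convex xi (risk x f) ->
  risk x f w + dotv (gradient (risk x f) w) (v - w)
    + xi / 2 * enorm (v - w) ^+ 2 <= risk x f v.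
Proof.
move=> N0 sc.
set D := enorm (v - w) ^+ 2; set I := dotv _ _.
set a := risk _ _ w; set b := risk _ _ v.
have D0 : 0 <= D by exact: sqr_ge0.
(* The absolute value keeps the error coefficient non-negative whatever the sign of [xi]. *)
have key t : 0 < t -> t <= 1 ->
    a + I + xi / 2 * D - b <= t * ((L + `|xi| / 2) * D).
  move=> t0 t1.
  have := sc v w t; rewrite t1 ltW// => /(_ isT).
  have /ler_normlP[h _] := risk_smooth w (t *: (v - w)) N0.
  move: h; rewrite dotvZr -/I enormZ gtr0_norm// exprMn -/D -/a -/b.
  have -> : w + t *: (v - w) = t *: v + (1 - t) *: w.
    by rewrite scalerBr scalerBl scale1r addrCA.
  set c := risk _ _ _ => h1 h2.
  have h3 : t * (a + I + xi / 2 * D - b) <= t * (t * (L + xi / 2) * D) by nra.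
  move: h3; rewrite ler_pM2l// => /le_trans; apply.
  rewrite -mulrA; apply: ler_wpM2l; first exact: ltW.
  by apply: ler_wpM2r => //; rewrite lerD2l ler_wpM2r// ler_norm.
rewrite -subr_le0 leNgt; apply/negP => pos.
set X := a + I + _ - b in pos key.
set Y := (L + _) * D in key.
have Y0 : 0 <= Y by rewrite mulr_ge0// addr_ge0 ?(ltW L0)// mulr_ge0.
have XY : X <= Y by have := key 1 ltr01 (lexx _); rewrite mul1r.
have Yp : 0 < Y by exact: lt_le_trans XY.
have Y2 : 0 < 2 * Y by rewrite mulr_gt0.
(* At t = X / (2 Y), which is at most 1 since X <= Y, the bound X <= t Y reads X <= X / 2. *)
have t0 : 0 < X / (2 * Y) by rewrite divr_gt0.
have t1 : X / (2 * Y) <= 1 by rewrite ler_pdivrMr//; lra.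
have := key _ t0 t1.
have -> : X / (2 * Y) * Y = X / 2 by field; rewrite lt0r_neq0.
lra.
Qed.

(** Completing the square: |g + xi (ws - w)|^2 >= 0 bounds the linear and quadratic terms of
    [strongly_convex_gradient] below by - |g|^2 / (2 xi). *)
Lemma polyak_lojasiewicz xi (ws w : 'cV[R]_d) : (0 < N)%N -> 0 < xi ->
  strongly_convex xi (risk x f) ->
  2 * xi * (risk x f w - risk x f ws) <= enorm (gradient (risk x f) w) ^+ 2.
Proof.
move=> N0 xi0 sc.
have h := strongly_convex_gradient w ws N0 sc.
have : 0 <= dotv (gradient (risk x f) w + xi *: (ws - w))
               (gradient (risk x f) w + xi *: (ws - w)).
  by rewrite dotvv sqr_ge0.
rewrite dotvDl !dotvDr !(dotvZl, dotvZr) (dotvC (ws - w) (gradient _ _)) !dotvv.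
move: h; set g := gradient _ _; set I := dotv _ _.
set n := enorm g; set D := enorm _; set a := risk _ _ _; set b := risk _ _ _.
nra.
Qed.

End Risk.
End Loss.

(** * Averages over the random sets *)

Section Subsets.
Context (R : realFieldType) (I : finType).
Implicit Types (S A : {set I}) (c : nat).

(** Defined on the whole type, in the shape used by [uniformly_distributed], so that expectations
    are sums over all values. *)
Definition uniform_weight (V : finType) (A : {set V}) (v : V) : R :=
  if v \in A then #|A|%:R^-1 else 0.

Lemma uniform_weight_ge0 (V : finType) (A : {set V}) v :
  0 <= uniform_weight A v.
Proof. by rewrite /uniform_weight; case: ifP. Qed.

Lemma sum_uniform_weight (V : finType) (A : {set V}) (a : V -> R) :
  \sum_v uniform_weight A v * a v = #|A|%:R^-1 * \sum_(v in A) a v.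
Proof.
rewrite mulr_sumr [RHS]big_mkcond; apply: eq_bigr => v _.
by rewrite /uniform_weight; case: ifP; rewrite ?mul0r.
Qed.

Lemma sum_uniform_weight1 (V : finType) (A : {set V}) :
  (0 < #|A|)%N -> \sum_v uniform_weight A v = 1.
Proof.
move=> A0; under eq_bigr do rewrite -[uniform_weight _ _]mulr1.
by rewrite sum_uniform_weight sumr_const mulVf// pnatr_eq0 -lt0n.
Qed.

Definition subsets_of S c :=
  [set A : {set I} | (A \subset S) && (#|A| == c)]%SET.

Lemma card_subsets_of S c : #|subsets_of S c| = 'C(#|S|, c).
Proof. exact: cards_draws. Qed.

(** Inserting [k] is a bijection onto this family from the [c]-subsets of [S :\ k]. *)
Lemma card_subsets_of_mem S c k : k \in S ->
  #|[set A in subsets_of S c.+1 | k \in A]%SET| = 'C(#|S|.-1, c).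
Proof.
move=> kS; have -> : #|S|.-1 = #|S :\ k| by rewrite (cardsD1 k S) kS.
rewrite -cards_draws.
set X := [set A : {set I} | A \subset S :\ k & _]%SET.
rewrite -(@card_in_imset _ _ (fun A : {set I} => k |: A) X); last first.
  move=> A A'; rewrite !inE => /andP[AS _] /andP[AS' _] e.
  have kA (Y : {set I}) : Y \subset S :\ k -> k \notin Y.
    by move=> YS; apply/negP => /(fintype.subsetP YS); rewrite !inE eqxx.
  by rewrite -(finset.setU1K (kA _ AS)) e finset.setU1K// kA.
apply: eq_card => A; rewrite !inE; apply/idP/imsetP.
  move=> /andP[/andP[AS Ac] kA]; exists (A :\ k); last by rewrite finset.setD1K.
  rewrite inE finset.setSD//=.
  by move: Ac; rewrite (cardsD1 k A) kA add1n eqSS.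
case=> Y; rewrite inE => /andP[YS Yc] ->.
have kY : k \notin Y.
  by apply/negP => /(fintype.subsetP YS); rewrite !inE eqxx.
rewrite finset.setU11 andbT cardsU1 kY add1n eqSS Yc andbT.
rewrite finset.subUset finset.sub1set kS/=.
exact: fintype.subset_trans YS (finset.subsetDl _ _).
Qed.

(** After exchanging the sums, each element of [S] lies in a fraction binomial(n - 1, c - 1) /
    binomial(n, c) = c / n of the subsets, where n = |S|. *)
Lemma mean_subsets_of S c (a : I -> R) : (0 < c <= #|S|)%N ->
  \sum_A uniform_weight (subsets_of S c) A * (\sum_(k in A) a k) =
  c%:R / #|S|%:R * \sum_(k in S) a k.
Proof.
case: c => [|c] // /andP[_ cS]; rewrite sum_uniform_weight.
have S0 : (0 < #|S|)%N by exact: leq_ltn_trans cS.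
have -> : \sum_(A in subsets_of S c.+1) \sum_(k in A) a k =
    \sum_(k in S) 'C(#|S|.-1, c)%:R * a k.
  rewrite (exchange_big_dep (mem S))/=.
    apply: eq_bigr => k kS; rewrite sumr_const -(card_subsets_of_mem c kS).
    rewrite mulr_natl; congr (_ *+ _).
    by apply: eq_card => A; rewrite [RHS]inE.
  by move=> A k; rewrite inE => /andP[/fintype.subsetP AS _] /AS.
rewrite -mulr_sumr mulrA; congr (_ * _).
rewrite card_subsets_of.
have C0 : 'C(#|S|, c.+1)%:R != 0 :> R by rewrite pnatr_eq0 -lt0n bin_gt0.
have Sn0 : #|S|%:R != 0 :> R by rewrite pnatr_eq0 -lt0n.
apply: (mulfI C0); rewrite mulrA divff// mul1r.
apply: (mulIf Sn0); rewrite mulrA mulfVK//.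
by rewrite -!natrM; congr (_%:R); rewrite [LHS]mulnC mul_bin_diag mulnC.
Qed.

End Subsets.

Arguments uniform_weight {R V} A v.

(** * Mean of the gradient estimate over the three random sets *)

Section GradientEstimate.
Context (R : realType) (N d : nat) (x : 'I_N -> 'rV[R]_d) (f : 'I_N -> R -> R).
Hypothesis df : forall i z, derivable (f i) z 1.

Definition mask (S : {set 'I_d}) (v : 'cV[R]_d) : 'cV[R]_d :=
  \col_k (if k \in S then v k 0 else 0).

Lemma dotv_mask (S : {set 'I_d}) (u v : 'cV[R]_d) :
  dotv u (mask S v) = \sum_(k in S) u k 0 * v k 0.
Proof.
rewrite /dotv [RHS]big_mkcond; apply: eq_bigr => k _.
by rewrite mxE; case: ifP; rewrite ?mulr0.
Qed.

Lemma enorm_mask (S : {set 'I_d}) (v : 'cV[R]_d) : enorm (mask S v) <= enorm v.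
Proof.
apply: enorm_le_sqr; first exact: enorm_ge0.
rewrite !enorm_sqr; apply: ler_sum => k _.
by rewrite mxE; case: ifP => // _; rewrite expr0n sqr_ge0.
Qed.

Lemma enorm_mask_sub (S : {set 'I_d}) (v : 'cV[R]_d) :
  enorm (mask S v - v) ^+ 2 = enorm v ^+ 2 - \sum_(k in S) v k 0 ^+ 2.
Proof.
rewrite !enorm_sqr [\sum_(k in S) _]big_mkcond -sumrB; apply: eq_bigr => k _.
by rewrite !mxE; case: ifP => _; rewrite ?subrr ?expr0n ?subr0// sub0r sqrrN.
Qed.

(** Dropping features from the inner product amounts to evaluating the gradient at the masked
    iterate, a form to which the Lipschitz hypothesis applies. *)
Lemma estimated_gradientE s (S C : {set 'I_d}) (D : {set 'I_N}) (w : 'cV[R]_d) :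
  estimated_gradient x f s S C D w =
  s%:R^-1 *: \sum_(j in D) mask C (gradient (loss (x j) (f j)) (mask S w)).
Proof.
congr (_ *: _); apply: eq_bigr => j _; apply/colP => k.
rewrite [LHS]mxE [RHS]mxE.
case: ifP => // _; rewrite gradient_loss// [RHS]mxE [(x j)^T k 0]mxE.
congr (_ * _).
congr (derive1 _ _); rewrite [RHS]mxE big_mkcond; apply: eq_bigr => l _.
by rewrite mxE; case: ifP; rewrite ?mulr0.
Qed.

(** Each observation is drawn with probability s / N, which cancels the factor 1 / s: with [S] and
    [C] fixed, the estimate is unbiased for the masked gradient at the masked point. *)
Lemma mean_observations s (g w : 'cV[R]_d) (S C : {set 'I_d}) :
  (0 < s <= N)%N ->
  \sum_D uniform_weight [set D : {set 'I_N} | #|D| == s]%SET D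
    * dotv g (estimated_gradient x f s S C D w)
  = \sum_(k in C) g k 0 * gradient (risk x f) (mask S w) k 0.
Proof.
move=> sN; have s0 : s%:R != 0 :> R by rewrite pnatr_eq0 -lt0n; case/andP: sN.
have -> : [set D : {set 'I_N} | #|D| == s]%SET = subsets_of [set: 'I_N]%SET s.
  by apply/setP => D; rewrite !inE finset.subsetT.
under eq_bigr => D _ do
  rewrite estimated_gradientE dotvZr dotv_sumr mulrCA.
rewrite -mulr_sumr mean_subsets_of ?cardsT ?card_ord//.
rewrite !mulrA mulVf// mul1r gradient_risk//.
under [RHS]eq_bigr => k _ do
  rewrite mxE summxE mulrCA mulr_sumr.
rewrite -mulr_sumr [in RHS]exchange_big/=; congr (_ * _).
apply: eq_big => [j|j _]; first by rewrite finset.in_setT.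
exact: dotv_mask.
Qed.

Lemma mean_coordinates b c (g w : 'cV[R]_d) (S : {set 'I_d}) :
  (0 < c <= b)%N -> #|S| = b ->
  \sum_C uniform_weight (subsets_of S c) C
    * (\sum_(k in C) g k 0 * gradient (risk x f) (mask S w) k 0)
  = c%:R / b%:R * \sum_(k in S) g k 0 * gradient (risk x f) (mask S w) k 0.
Proof. by move=> cb Sb; rewrite mean_subsets_of Sb. Qed.

Variable L : R.
Hypothesis lipL : forall i v v',
  enorm (gradient (loss (x i) (f i)) v - gradient (loss (x i) (f i)) v')
    <= L * enorm (v - v').
Hypothesis L0 : 0 < L.
Hypothesis N0 : (0 < N)%N.

Lemma mean_features b (a : 'I_d -> R) : (0 < b <= d)%N ->
  \sum_S uniform_weight [set S : {set 'I_d} | #|S| == b]%SET S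
    * (\sum_(k in S) a k) = b%:R / d%:R * \sum_k a k.
Proof.
move=> bd.
have -> : [set S : {set 'I_d} | #|S| == b]%SET = subsets_of [set: 'I_d]%SET b.
  by apply/setP => D; rewrite !inE finset.subsetT.
rewrite mean_subsets_of ?cardsT ?card_ord//; congr (_ * _).
by apply: eq_bigl => k; rewrite inE.
Qed.

(** By the Lipschitz bound it suffices to average the squared norm of the masked-out part of [w]; a
    coordinate is masked out with probability 1 - b / d. *)
Lemma mean_masking_error b (w : 'cV[R]_d) : (0 < b <= d)%N ->
  \sum_S uniform_weight [set S : {set 'I_d} | #|S| == b]%SET S
    * enorm (gradient (risk x f) (mask S w) - gradient (risk x f) w) ^+ 2
  <= L ^+ 2 * ((1 - b%:R / d%:R) * enorm w ^+ 2).
Proof.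
move=> bd; set B := [set S | _]%SET.
have B0 : (0 < #|B|)%N.
  by rewrite /B card_draws card_ord bin_gt0; case/andP: bd.
apply: (@le_trans _ _ (\sum_S uniform_weight B S *
    (L ^+ 2 * (enorm w ^+ 2 - \sum_(k in S) w k 0 ^+ 2)))).
  apply: ler_sum => S _; apply: ler_wpM2l; first exact: uniform_weight_ge0.
  rewrite -enorm_mask_sub -exprMn.
  rewrite ler_pXn2r ?nnegrE ?mulr_ge0 ?enorm_ge0 ?(ltW L0)//.
  exact: gradient_risk_lipschitz.
under eq_bigr => S _ do rewrite mulrCA mulrBr.
rewrite -mulr_sumr ler_wpM2l ?sqr_ge0// sumrB mean_features// -mulr_suml.
by rewrite sum_uniform_weight1// mul1r mulrBl mul1r -enorm_sqr.
Qed.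

(* Young's inequality with weight [d gamma / c] makes both the masking error
   and the loss in the squared gradient of order [gamma]. *)
Lemma mean_descent b c s gamma eta M2 (w : 'cV[R]_d) :
  (0 < c <= b)%N -> (b <= d)%N -> (0 < s <= N)%N -> 0 < gamma ->
  L ^+ 2 * ((1 - b%:R / d%:R) * (M2 / 2) ^+ 2)
    <= d%:R * eta * gamma ^+ 2 / c%:R ->
  enorm w <= M2 / 2 -> 0 <= eta ->
  c%:R / d%:R * enorm (gradient (risk x f) w) ^+ 2
    - gamma / 2 * (enorm (gradient (risk x f) w) ^+ 2 + eta)
  <= \sum_S \sum_C \sum_D
       uniform_weight [set S : {set 'I_d} | #|S| == b]%SET S
       * uniform_weight (subsets_of S c) C
       * uniform_weight [set D : {set 'I_N} | #|D| == s]%SET D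
       * dotv (gradient (risk x f) w) (estimated_gradient x f s S C D w).
Proof.
move=> cb bd sN gamma0 hb wM eta0.
set g := gradient _ w; set B := [set S | _]%SET.
have c0 : 0 < c%:R :> R by rewrite ltr0n; case/andP: cb.
have b0n : (0 < b)%N by case/andP: cb; exact: leq_trans.
have b0 : 0 < b%:R :> R by rewrite ltr0n.
have d0 : 0 < d%:R :> R by rewrite ltr0n (leq_trans b0n).
have cbR : c%:R <= b%:R :> R by rewrite ler_nat; case/andP: cb.
have bdR : b%:R <= d%:R :> R by rewrite ler_nat.
pose h S := gradient (risk x f) (mask S w) - g.
pose al := d%:R * gamma / c%:R.
have al0 : 0 < al by rewrite divr_gt0// mulr_gt0.
rewrite (_ : \sum_S _ = \sum_S uniform_weight B S *
    (c%:R / b%:R * \sum_(k in S) g k 0 * gradient (risk x f) (mask S w) k 0));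
    last first.
  (* Observations are averaged first, then coordinates. The latter needs |S| = b; sets of another
     size have weight zero. *)
  apply: eq_bigr => S _; case: (boolP (S \in B)) => SB.
    rewrite -mean_coordinates//; last by move: SB; rewrite inE => /eqP.
    rewrite mulr_sumr; apply: eq_bigr => C _.
    rewrite -(mean_observations _ _ _ _ sN) !mulr_sumr; apply: eq_bigr => D _.
    by rewrite !mulrA.
  have uS : uniform_weight B S = 0 :> R by rewrite /uniform_weight (negbTE SB).
  rewrite uS mul0r big1// => C _; rewrite big1// => D _.
  by rewrite !mul0r.
apply: (@le_trans _ _ (\sum_S uniform_weight B S * (c%:R / b%:R *
    ((1 - al / 2) * (\sum_(k in S) g k 0 ^+ 2)
     - (2 * al)^-1 * enorm (h S) ^+ 2)))); last first.
  apply: ler_sum => S _; apply: ler_wpM2l; first exact: uniform_weight_ge0.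
  apply: ler_wpM2l; first by rewrite divr_ge0 ?ltW.
  apply: (@le_trans _ _ ((1 - al / 2) * (\sum_(k in S) g k 0 ^+ 2)
     - (2 * al)^-1 * \sum_(k in S) h S k 0 ^+ 2)).
    rewrite lerD2l lerN2; apply: ler_wpM2l.
      by rewrite invr_ge0 mulr_ge0// ltW.
    rewrite enorm_sqr [leLHS]big_mkcond; apply: ler_sum => k _.
    by case: ifP => // _; exact: sqr_ge0.
  rewrite !mulr_sumr -sumrB; apply: ler_sum => k _.
  have -> : gradient (risk x f) (mask S w) k 0 = g k 0 + h S k 0.
    by rewrite [h S k 0]mxE [(- g) k 0]mxE [RHS]addrC subrK.
  rewrite -subr_ge0; set u := g k 0; set v := h S k 0.
  have -> : u * (u + v) - ((1 - al / 2) * u ^+ 2 - (2 * al)^-1 * v ^+ 2) =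
    (2 * al)^-1 * (al * u + v) ^+ 2 by field; rewrite lt0r_neq0.
  by rewrite mulr_ge0 ?sqr_ge0// invr_ge0 mulr_ge0// ltW.
have lin (a1 a2 a3 : R) (u p q : {set 'I_d} -> R) :
    \sum_S u S * (a1 * (a2 * p S - a3 * q S)) =
    a1 * (a2 * (\sum_S u S * p S) - a3 * \sum_S u S * q S).
  by rewrite !mulr_sumr -sumrB mulr_sumr; apply: eq_bigr => S _; ring.
rewrite lin mean_features ?b0n// -enorm_sqr.
set E := \sum_S _; set n := enorm g ^+ 2.
have hE : E <= d%:R * eta * gamma ^+ 2 / c%:R.
  apply: (le_trans (mean_masking_error _ _)); first by rewrite b0n.
  apply: le_trans hb; rewrite ler_wpM2l ?sqr_ge0// ler_wpM2l//.
    by rewrite subr_ge0 ler_pdivrMr// mul1r.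
  by rewrite ler_pXn2r// nnegrE ?enorm_ge0// (le_trans _ wM)// enorm_ge0.
(* With [al] = d gamma / c, the loss in the squared gradient has coefficient exactly gamma / 2; c <=
   b then bounds the masking term by gamma eta / 2. *)
have -> : c%:R / b%:R * ((1 - al / 2) * (b%:R / d%:R * n) - (2 * al)^-1 * E) =
  c%:R / d%:R * n - gamma / 2 * n - c%:R ^+ 2 / (2 * b%:R * d%:R * gamma) * E.
  by rewrite /al; field; rewrite !lt0r_neq0.
have : c%:R ^+ 2 / (2 * b%:R * d%:R * gamma) * E <= gamma / 2 * eta; last lra.
have q0 : 0 <= c%:R ^+ 2 / (2 * b%:R * d%:R * gamma).
  by rewrite divr_ge0 ?sqr_ge0// !mulr_ge0// ltW.
apply: (le_trans (ler_wpM2l q0 hE)).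
have -> : c%:R ^+ 2 / (2 * b%:R * d%:R * gamma) *
    (d%:R * eta * gamma ^+ 2 / c%:R) = c%:R / b%:R * (gamma / 2 * eta).
  by field; rewrite !lt0r_neq0.
rewrite ler_piMl ?mulr_ge0// ?(ltW gamma0)//.
by rewrite ler_pdivrMr// mul1r.
Qed.

End GradientEstimate.

(** * The outer step *)

Section Blocks.
Context (d Q P : nat).
Local Notation m := (d %/ (Q * P))%N.

(** [feat] is a mixed-radix expansion, decoded by quotients and remainders modulo m and then P, both
    positive since their ordinals are inhabited. *)
Lemma feat_inj (q q' : 'I_Q) (k k' : 'I_P) (l l' : 'I_m) :
  feat q k l = feat q' k' l' -> [/\ q = q', k = k' & l = l'].
Proof.
move=> /(congr1 val)/= e.
have m0 : (0 < m)%N by exact: leq_ltn_trans (ltn_ord l).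
have P0 : (0 < P)%N by exact: leq_ltn_trans (ltn_ord k).
have e1 := congr1 (divn^~ m) e; have e2 := congr1 (modn^~ m) e.
rewrite /= !divnMDl// !divn_small// !addn0 in e1.
rewrite /= !modnMDl !modn_small// in e2.
have e3 := congr1 (divn^~ P) e1; have e4 := congr1 (modn^~ P) e1.
rewrite /= !divnMDl// !divn_small// !addn0 in e3.
rewrite /= !modnMDl !modn_small// in e4.
by split; exact: val_inj.
Qed.

(** By divisibility there are exactly d triples, so the injective map [feat] is a bijection. *)
Lemma sum_feat (V : nmodType) (G : 'I_d -> V) : (Q * P %| d)%N ->
  \sum_a G a = \sum_q \sum_k \sum_l G (@feat d Q P q k l).
Proof.
move=> dvd; pose h (u : 'I_Q * ('I_P * 'I_m)) := feat u.1 u.2.1 u.2.2.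
have h_inj : injective h.
  by move=> [q [k l]] [q' [k' l']] /feat_inj/= [-> -> ->].
have h_bij : bijective h.
  apply: inj_card_bij => //.
  by rewrite !card_prod !card_ord mulnA mulnC divnK.
rewrite (reindex h); last exact: onW_bij.
rewrite -(pair_bigA _ (fun q u => G (h (q, u))))/=.
by apply: eq_bigr => q _; rewrite -(pair_bigA _ (fun k l => G (h (q, (k, l))))).
Qed.

End Blocks.

Section Embedding.
Context (R : realType) (m d : nat) (h : 'I_m -> 'I_d).
Hypothesis h_inj : injective h.

(** Zero padding along [h]. For injective [h] the sum has at most one term, which avoids choosing a
    preimage. *)
Definition extend (v : 'cV[R]_m) : 'cV[R]_d :=
  \col_a \sum_(l | h l == a) v l 0.

Lemma extendB (u v : 'cV[R]_m) : extend (u - v) = extend u - extend v.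
Proof.
apply/colP => a; rewrite !mxE -sumrB; apply: eq_bigr => l _.
by rewrite !mxE.
Qed.

Lemma enorm_extend (v : 'cV[R]_m) : enorm (extend v) = enorm v.
Proof.
congr Num.sqrt.
transitivity (\sum_a \sum_(l | h l == a) v l 0 ^+ 2).
  apply: eq_bigr => a _; rewrite mxE.
  have [/existsP[l /eqP <-]|/existsPn e] := boolP [exists l, h l == a].
    by rewrite !(big_pred1 l)// => i; rewrite /= (inj_eq h_inj).
  by rewrite !big_pred0 ?expr0n// => l; exact/negbTE.
rewrite (exchange_big_dep xpredT)//=; apply: eq_bigr => l _.
by rewrite (big_pred1 (h l))// => a; rewrite /= eq_sym.
Qed.

Lemma enorm_rowsub (v : 'cV[R]_d) : enorm (rowsub h v) <= enorm v.
Proof.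
rewrite -[enorm (rowsub _ _)]enorm_extend.
apply: enorm_le_sqr; first exact: enorm_ge0.
rewrite !enorm_sqr; apply: ler_sum => a _; rewrite mxE.
have [/existsP[l /eqP <-]|/existsPn e] := boolP [exists l, h l == a].
  by rewrite (big_pred1 l) ?mxE// => i; rewrite /= (inj_eq h_inj).
by rewrite big_pred0 ?expr0n ?sqr_ge0// => l; exact/negbTE.
Qed.

Lemma colsub_mul (x : 'rV[R]_d) (v : 'cV[R]_m) :
  (colsub h x *m v) 0 0 = (x *m extend v) 0 0.
Proof.
rewrite !mxE; under [RHS]eq_bigr do rewrite mxE mulr_sumr.
rewrite (exchange_big_dep xpredT)//=; apply: eq_bigr => l _.
by rewrite mxE (big_pred1 (h l))// => a; rewrite /= eq_sym.
Qed.

Lemma gradient_colsub (x : 'rV[R]_d) (f : R -> R) (v : 'cV[R]_m) :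
  (forall z, derivable f z 1) ->
  gradient (loss (colsub h x) f) v = rowsub h (gradient (loss x f) (extend v)).
Proof.
move=> df; rewrite !gradient_loss// colsub_mul; apply/colP => l.
by rewrite !mxE.
Qed.

(** A local loss is the full loss composed with the isometric embedding [extend], and its gradient
    is a restriction of the full one, which does not increase norms. *)
Lemma gradient_colsub_lipschitz (x : 'rV[R]_d) (f : R -> R) (L : R) :
  (forall z, derivable f z 1) ->
  (forall v v',
    enorm (gradient (loss x f) v - gradient (loss x f) v')
      <= L * enorm (v - v')) ->
  forall v v',
    enorm (gradient (loss (colsub h x) f) v - gradient (loss (colsub h x) f) v')
      <= L * enorm (v - v').
Proof.
move=> df lip v v'; rewrite !gradient_colsub//.
rewrite (_ : rowsub h _ - _ = rowsub h
    (gradient (loss x f) (extend v) - gradient (loss x f) (extend v')));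
    last first.
  by apply/colP => l; rewrite !mxE.
apply: (le_trans (enorm_rowsub _)).
by rewrite -[enorm (v - v')]enorm_extend extendB.
Qed.

End Embedding.

(** * Drift of the variance-reduced inner steps *)

Section InnerIteration.
Context (R : realType) (m : nat) (J : Type) (lg : J -> 'cV[R]_m -> 'cV[R]_m).
Context (gamma L : R) (mu w0 : 'cV[R]_m).
Hypothesis gamma0 : 0 <= gamma.
Hypothesis L0 : 0 <= L.
Hypothesis lg_lip :
  forall j v v', enorm (lg j v - lg j v') <= L * enorm (v - v').

Definition svrg_step (v : 'cV[R]_m) (j : J) : 'cV[R]_m :=
  v - gamma *: (lg j v - lg j w0 + mu).

Let q := 1 + gamma * L.

Let q1 : 1 <= q. Proof. by rewrite lerDl mulr_ge0. Qed.

(** A discrete Gronwall argument: one step maps the distance a to [w0] to at most q a + gamma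
    |mu|. *)
Lemma svrg_drift s :
  enorm (foldl svrg_step w0 s - w0)
    <= gamma * enorm mu * ((size s)%:R * q ^+ size s).
Proof.
elim/last_ind: s => [|s j IH]; first by rewrite subrr enorm0 mul0r mulr0.
rewrite foldl_rcons size_rcons; set v := foldl _ _ _ in IH *.
rewrite (_ : svrg_step v j - w0 = (v - w0) +
  ((- gamma) *: (lg j v - lg j w0) + (- gamma) *: mu)); last first.
  by rewrite /svrg_step !scaleNr scalerDr opprD addrAC.
apply: (le_trans (enorm_triangle _ _)).
have h1 := enorm_triangle ((- gamma) *: (lg j v - lg j w0)) ((- gamma) *: mu).
rewrite !enormZ normrN ger0_norm// in h1.
have h2 := ler_wpM2l gamma0 (lg_lip j v w0).
set n := size s in IH *; set a := enorm (v - w0) in IH h2 *.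
apply: (@le_trans _ _ (q * a + gamma * enorm mu)).
  by rewrite /q; lra.
apply: (@le_trans _ _
  (q * (gamma * enorm mu * (n%:R * q ^+ n)) + gamma * enorm mu)).
  by rewrite lerD2r ler_wpM2l// (le_trans ler01).
have -> : q * (gamma * enorm mu * (n%:R * q ^+ n)) =
  gamma * enorm mu * (n%:R * q ^+ n.+1) by rewrite exprS; ring.
rewrite -natr1 mulrDl mul1r mulrDr lerD2l ler_peMr ?exprn_ege1//.
by rewrite mulr_ge0// enorm_ge0.
Qed.

(** Apart from its share - gamma mu, each step contributes only gamma times a gradient difference,
    at most gamma L times the drift. *)
Lemma svrg_residual s :
  enorm (foldl svrg_step w0 s - w0 + (gamma * (size s)%:R) *: mu)
    <= gamma ^+ 2 * L * enorm mu * ((size s)%:R ^+ 2 * q ^+ size s).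
Proof.
elim/last_ind: s => [|s j IH].
  by rewrite subrr mulr0 scale0r addr0 enorm0 expr0n/= !(mul0r, mulr0).
have := svrg_drift s.
rewrite foldl_rcons size_rcons; set v := foldl _ _ _ in IH *.
set n := size s in IH *; set a := enorm (v - w0) => ha.
rewrite (_ : _ + _ = (v - w0 + (gamma * n%:R) *: mu)
    + (- gamma) *: (lg j v - lg j w0)); last first.
  rewrite /svrg_step -natr1 mulrDr mulr1 scalerDl scalerDr scaleNr opprD.
  apply/colP => i; rewrite !mxE; ring.
apply: (le_trans (enorm_triangle _ _)).
rewrite enormZ normrN ger0_norm//.
have h2 := ler_wpM2l gamma0 (lg_lip j v w0).
have h3 := ler_wpM2l (mulr_ge0 gamma0 L0) ha.
set M := enorm mu in IH ha h3 *.
have M0 : 0 <= M by exact: enorm_ge0.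
(* The induction hypothesis contributes n^2 and the drift n, and n^2 + n <= (n + 1)^2. *)
apply: (@le_trans _ _ (gamma ^+ 2 * L * M * ((n%:R ^+ 2 + n%:R) * q ^+ n))).
  rewrite -/a in h2; lra.
apply: ler_wpM2l; first by rewrite !mulr_ge0// sqr_ge0.
apply: ler_pM.
- by rewrite addr_ge0// sqr_ge0.
- by rewrite exprn_ge0// (le_trans ler01).
- by rewrite -natr1 sqrrD1; have := ler0n R n; lra.
- by rewrite exprS ler_peMl// exprn_ge0// (le_trans ler01).
Qed.

End InnerIteration.

Section Step.
Context (R : realType) (N d P Q B : nat).
Context (x : 'I_N -> 'rV[R]_d) (f : 'I_N -> R -> R).
Context (obs : 'I_P * 'I_(N %/ P) -> 'I_N) (gamma L : R).
Hypothesis df : forall i z, derivable (f i) z 1.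
Hypothesis lipL : forall i v v',
  enorm (gradient (loss (x i) (f i)) v - gradient (loss (x i) (f i)) v')
    <= L * enorm (v - v').
Hypothesis L0 : 0 < L.
Hypothesis N0 : (0 < N)%N.
Hypothesis gamma0 : 0 < gamma.
Hypothesis small : B%:R * L * gamma <= 1.
Hypothesis dvd : (Q * P %| d)%N.

Local Notation step_gradient s u w :=
  (estimated_gradient x f s (@feature_set N d P Q B u) (coordinate_set u)
     (observation_set u) w).

Let kappa := gamma ^+ 2 * L * B%:R ^+ 2 * expR 1.

(** By [small], (1 + gamma L)^B <= exp (B gamma L) <= e, so the power in [svrg_residual] is bounded
    by a constant. *)
Lemma inner_loop_residual (mu w : 'cV[R]_d) (p : 'I_P) (q : 'I_Q) (k : 'I_P)
    (js : 'I_B -> 'I_(N %/ P)) :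
  enorm (inner_loop x f obs gamma mu w p q k js
      - rowsub (feat q k) w + (gamma * B%:R) *: rowsub (feat q k) mu)
    <= kappa * enorm (rowsub (@feat d Q P q k) mu).
Proof.
pose lg (i : 'I_B) := gradient
  (loss (colsub (feat q k) (x (obs (p, js i)))) (f (obs (p, js i)))).
have finj : injective (@feat d Q P q k) by move=> l l' /feat_inj[].
have := @svrg_residual R _ _ lg gamma L (rowsub (feat q k) mu)
  (rowsub (feat q k) w) (ltW gamma0) (ltW L0)
  (fun i => gradient_colsub_lipschitz finj (@df (obs (p, js i)))
    (@lipL (obs (p, js i)))) (enum 'I_B).
rewrite size_enum_ord => /le_trans; apply.
set M := enorm _; have M0 : 0 <= M by exact: enorm_ge0.
rewrite (_ : kappa * M = gamma ^+ 2 * L * M * (B%:R ^+ 2 * expR 1)); last first.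
  by rewrite /kappa; ring.
apply: ler_wpM2l; first by rewrite !mulr_ge0 ?sqr_ge0// ltW.
apply: ler_wpM2l; first exact: sqr_ge0.
apply: (@le_trans _ _ (expR (gamma * L) ^+ B)).
  rewrite lerXn2r ?nnegrE ?expR_ge0 ?expR_ge1Dx//.
  by rewrite addr_ge0// mulr_ge0// ltW.
by rewrite -expRM_natl ler_expR mulrA mulrAC.
Qed.

Lemma sodda_step_feat s (u : draw N d P Q B) (w : 'cV[R]_d) q p l :
  sodda_step x f obs gamma s u w (feat q (assignment u q p) l) 0 =
  inner_loop x f obs gamma (step_gradient s u w) w p q
    (assignment u q p) (Defs.pick u p q) l 0.
Proof.
rewrite mxE (bigD1 q)//= (bigD1 p)//= (big_pred1 l); last first.
  by move=> l'; apply/eqP/eqP => [/feat_inj[]|->].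
rewrite [X in _ + X + _]big1 ?addr0 => [|p' p'p]; last first.
  rewrite big_pred0// => l'; apply/negP => /eqP/feat_inj[_ /perm_inj e _].
  by rewrite e eqxx in p'p.
rewrite [X in _ + X]big1 ?addr0// => q' q'q; rewrite big1// => p' _.
rewrite big_pred0// => l'; apply/negP => /eqP/feat_inj[e _ _].
by rewrite e eqxx in q'q.
Qed.

(** The sub-blocks partition the coordinates and each is updated by one processor, so squared block
    residuals add up; reindexing by the bijections puts both sums in processor order. *)
Lemma sodda_step_residual s (u : draw N d P Q B) (w : 'cV[R]_d) :
  enorm (sodda_step x f obs gamma s u w - w
         + (gamma * B%:R) *: step_gradient s u w)
    <= kappa * enorm (step_gradient s u w).
Proof.
set mu := estimated_gradient _ _ _ _ _ _ _; have kappa0 : 0 <= kappa.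
  by rewrite !mulr_ge0 ?sqr_ge0 ?expR_ge0// ltW.
apply: enorm_le_sqr; first by rewrite mulr_ge0// enorm_ge0.
rewrite exprMn !enorm_sqr !(sum_feat _ dvd) mulr_sumr; apply: ler_sum => q _.
rewrite (reindex_inj (@perm_inj _ (assignment u q))) 
  [X in _ <= _ * X](reindex_inj (@perm_inj _ (assignment u q))).
rewrite mulr_sumr; apply: ler_sum => p _.
set k := assignment u q p.
have h := inner_loop_residual mu w p q k (Defs.pick u p q).
have e l : (sodda_step x f obs gamma s u w - w + (gamma * B%:R) *: mu)
    (feat q k l) 0 = (inner_loop x f obs gamma mu w p q k (Defs.pick u p q)
      - rowsub (feat q k) w + (gamma * B%:R) *: rowsub (feat q k) mu) l 0.
  rewrite [LHS]mxE [RHS]mxE; congr (_ + _); last by rewrite !mxE.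
  rewrite [LHS]mxE [RHS]mxE; congr (_ + _); first exact: sodda_step_feat.
  by rewrite !mxE.
have e' l : mu (feat q k l) 0 = rowsub (feat q k) mu l 0 by rewrite [RHS]mxE.
under eq_bigr => l _ do rewrite e.
under [X in _ <= _ * X]eq_bigr => l _ do rewrite e'.
rewrite -!enorm_sqr -exprMn.
by rewrite ler_pXn2r ?nnegrE ?enorm_ge0// mulr_ge0 ?enorm_ge0.
Qed.

(** A crude bound: 1 / s <= 1, there are at most N terms, and masking moves the point by at most
    |w|. *)
Lemma enorm_estimated_gradient s (S C : {set 'I_d}) (D : {set 'I_N})
    (w : 'cV[R]_d) (K : R) : (0 < s)%N ->
  (forall j, enorm (gradient (loss (x j) (f j)) w) <= K) ->
  enorm (estimated_gradient x f s S C D w) <= N%:R * (K + L * enorm w).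
Proof.
move=> s0 hK; rewrite estimated_gradientE// enormZ ger0_norm ?invr_ge0//.
have K0 : 0 <= K + L * enorm w.
  apply: addr_ge0; last by rewrite mulr_ge0 ?enorm_ge0// ltW.
  by apply: le_trans (hK (Ordinal N0)); exact: enorm_ge0.
apply: (@le_trans _ _ (1 * enorm (\sum_(j in D)
    mask C (gradient (loss (x j) (f j)) (mask S w))))).
  by rewrite ler_wpM2r ?enorm_ge0// invf_le1 ?ltr0n// ler1n.
rewrite mul1r; apply: (le_trans (enorm_sum _ _ _)).
rewrite -[in leRHS](card_ord N) mulr_natl -sumr_const big_mkcond.
apply: ler_sum => j _; case: ifP => // _.
apply: (le_trans (enorm_mask _ _)).
rewrite -[gradient _ _](subrK (gradient (loss (x j) (f j)) w)) addrC.
apply: (le_trans (enorm_triangle _ _)); apply: lerD => //.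
apply: (le_trans (lipL _ _ _)); apply: ler_wpM2l; first exact: ltW.
apply: enorm_le_sqr; first exact: enorm_ge0.
by rewrite enorm_mask_sub gerBl sumr_ge0// => k _; exact: sqr_ge0.
Qed.

(** The increment is - gamma B mu + r with r the residual. In the error constant, the first term
    comes from the inner product with r, the second from the quadratic term of smoothness. *)
Lemma risk_sodda_step s (u : draw N d P Q B) (w : 'cV[R]_d) (K Gm : R) :
  let mu := step_gradient s u w in
  enorm mu <= K -> enorm (gradient (risk x f) w) <= Gm ->
  risk x f (sodda_step x f obs gamma s u w) <=
    risk x f w - gamma * B%:R * dotv (gradient (risk x f) w) mu
    + (Gm * L * expR 1 * K + L * (1 + expR 1) ^+ 2 * K ^+ 2)
      * (gamma ^+ 2 * B%:R ^+ 2).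
Proof.
move=> mu muK gG; set w' := sodda_step _ _ _ _ _ _ _.
have K0 : 0 <= K by apply: le_trans muK; exact: enorm_ge0.
have G0 : 0 <= Gm by apply: le_trans gG; exact: enorm_ge0.
have e0 : 0 < expR 1 :> R by exact: expR_gt0.
have B0 : 0 <= B%:R :> R by [].
set r := w' - w + (gamma * B%:R) *: mu.
have hr : enorm r <= kappa * K.
  apply: (le_trans (sodda_step_residual s u w)).
  by rewrite ler_wpM2l// !mulr_ge0 ?sqr_ge0 ?expR_ge0// ltW.
have hw : w' = w + (- (gamma * B%:R) *: mu + r).
  by rewrite /r scaleNr [w' - w + _]addrC addKr [RHS]addrC subrK.
set e := expR 1 in e0 hr *.
(* For the quadratic term a first-order bound on the residual is enough: [small] absorbs one factor
   B L gamma. *)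
have hk : kappa <= gamma * B%:R * e.
  rewrite /kappa -/e ler_wpM2r ?(ltW e0)//.
  have := ler_wpM2l (mulr_ge0 (ltW gamma0) B0) small; lra.
have hD : enorm (- (gamma * B%:R) *: mu + r) <= gamma * B%:R * ((1 + e) * K).
  apply: (le_trans (enorm_triangle _ _)).
  rewrite enormZ normrN ger0_norm ?mulr_ge0 ?(ltW gamma0)//.
  have := ler_wpM2l (mulr_ge0 (ltW gamma0) B0) muK.
  have := ler_wpM2r K0 hk; lra.
have hgr : dotv (gradient (risk x f) w) r <= Gm * (kappa * K).
  apply: (le_trans (dotv_le _ _)); apply: ler_pM => //; exact: enorm_ge0.
have /ler_normlP[_] := risk_smooth df lipL L0 w (- (gamma * B%:R) *: mu + r) N0.
rewrite -hw dotvDr dotvZr => h1.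
have h2 : L * enorm (- (gamma * B%:R) *: mu + r) ^+ 2 <=
    L * (gamma * B%:R * ((1 + e) * K)) ^+ 2.
  rewrite ler_pM2l// ler_pXn2r// nnegrE ?enorm_ge0//.
  by rewrite !mulr_ge0 ?addr_ge0// ltW.
have h3 :
    (Gm * L * e * K + L * (1 + e) ^+ 2 * K ^+ 2) * (gamma ^+ 2 * B%:R ^+ 2)
  = Gm * (kappa * K) + L * (gamma * B%:R * ((1 + e) * K)) ^+ 2.
  by rewrite /kappa -/e; ring.
rewrite h3; lra.
Qed.

End Step.

(** * Histories and independence *)

Section FiniteValued.
Context (R : realType) (disp : measure_display) (T : measurableType disp).
Context (Pr : probability T R) (V : finType) (X : T -> V).
Hypothesis mX : forall v, measurable (X @^-1` [set v]).

Let mass v := fine (Pr (X @^-1` [set v])).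

Lemma finite_valued_sum (phi : V -> R) o :
  phi (X o) = \sum_v phi v * \1_(X @^-1` [set v]) o.
Proof.
rewrite (bigD1 (X o))//= indicE mem_set// mulr1 big1 ?addr0// => v vX.
rewrite indicE memNset ?mulr0// => /= e.
by rewrite e eqxx in vX.
Qed.

Lemma finite_valued_integrable (phi : V -> R) :
  Pr.-integrable setT (EFin \o (phi \o X)).
Proof.
rewrite (_ : _ \o _ =
  fun o => (\sum_v (phi v)%:E * (\1_(X @^-1` [set v]) o)%:E)%E); last first.
  by apply/funext => o; rewrite /= finite_valued_sum -sumEFin.
apply: integrable_sum => // v _; apply: integrableZl => //.
exact: integrable_indic.
Qed.

Lemma finite_valued_mean (phi : V -> R) :
  \int[Pr]_o phi (X o) = \sum_v phi v * mass v.
Proof.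
rewrite /Rintegral (_ : (fun o => _) =
  fun o => (\sum_v (phi v)%:E * (\1_(X @^-1` [set v]) o)%:E)%E); last first.
  by apply/funext => o; rewrite /= finite_valued_sum -sumEFin.
rewrite integral_sum//=; last first.
  by move=> v; apply: integrableZl => //; exact: integrable_indic.
rewrite (_ : (\sum_v _)%E = (\sum_v phi v * mass v)%:E)//.
rewrite -sumEFin; apply: eq_bigr => v _.
rewrite integralZl//; last exact: integrable_indic.
by rewrite integral_indic// setIT EFinM fineK// fin_num_measure.
Qed.

Lemma mass_ge0 v : 0 <= mass v.
Proof. exact/fine_ge0/measure_ge0. Qed.

(** A value of positive mass is attained outside the exceptional null set, so the inequality holds
    at each such value. *)
Lemma finite_valued_le (phi psi : V -> R) :
  {ae Pr, forall o, phi (X o) <= psi (X o)} ->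
  \int[Pr]_o phi (X o) <= \int[Pr]_o psi (X o).
Proof.
move=> [Z [mZ Z0 sub]]; rewrite !finite_valued_mean.
apply: ler_sum => v _; have [m0|m0] := eqVneq (mass v) 0.
  by rewrite m0 !mulr0.
have : exists o, X o = v /\ ~ Z o.
  apply: contrapT => nex; move/eqP: m0; apply.
  rewrite /mass (_ : Pr _ = 0%E)//; apply/eqP.
  rewrite eq_le measure_ge0 andbT -Z0 le_measure ?inE// => o /= Xo.
  by apply: contrapT => oZ; apply: nex; exists o.
case=> o0 [Xo oZ]; apply: ler_wpM2r; first exact: mass_ge0.
by rewrite -Xo; apply: contrapT => h; apply/oZ/sub.
Qed.

End FiniteValued.

Section IndependentPair.
Context (R : realType) (disp : measure_display) (T : measurableType disp).
Context (Pr : probability T R) (V W : finType) (X : T -> V) (Y : T -> W).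
Hypothesis mX : forall v, measurable (X @^-1` [set v]).
Hypothesis mY : forall v, measurable (Y @^-1` [set v]).
Context (p : W -> R).
Hypothesis XY : forall v y,
  Pr (X @^-1` [set v] `&` Y @^-1` [set y]) =
  (Pr (X @^-1` [set v]) * (p y)%:E)%E.

(** The joint law is a product, so [Y] can be averaged out with [X] fixed. It is applied with [X]
    the history and [Y] the three current sets. *)
Lemma independent_mean (Phi : V -> W -> R) :
  \int[Pr]_o Phi (X o) (Y o) = \int[Pr]_o \sum_y p y * Phi (X o) y.
Proof.
have e v : (fun o => (X o, Y o)) @^-1` [set v] =
    X @^-1` [set v.1] `&` Y @^-1` [set v.2].
  apply/seteqP; split => o /=; first by case: v => v y [-> ->].
  by case: v => v y /= [-> ->].
have mXY v : measurable ((fun o => (X o, Y o)) @^-1` [set v]).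
  by rewrite e; exact: measurableI.
rewrite (finite_valued_mean Pr mXY (fun v => Phi v.1 v.2)).
rewrite (finite_valued_mean Pr mX (fun v => \sum_y p y * Phi v y)).
transitivity (\sum_v \sum_y Phi v y *
    fine (Pr ((fun o => (X o, Y o)) @^-1` [set (v, y)]))).
  by rewrite pair_bigA; apply: eq_bigr => -[].
apply: eq_bigr => v _; rewrite mulr_suml; apply: eq_bigr => y _.
by rewrite e/= XY fineM ?fin_num_measure//=; ring.
Qed.

End IndependentPair.

(** [a0] serves as the value of [psi] outside the image of [X]. *)
Lemma factor_through (T V : Type) (A : Type) (a0 : A) (X : T -> V)
    (phi : T -> A) :
  (forall o o', X o = X o' -> phi o = phi o') ->
  exists psi : V -> A, phi = psi \o X.
Proof.
move=> h; exists (fun v => if pselect (exists o, X o = v) is left e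
  then phi (projT1 (cid e)) else a0).
apply/funext => o /=; case: pselect => [e|[]]; last by exists o.
by apply: h; rewrite (projT2 (cid e)).
Qed.

Lemma mutually_independent_finite (R : realType) (disp : measure_display)
    (T : measurableType disp) (Pr : probability T R) (J : Type)
    (E : J -> set (set T)) (I : finType) (a : I -> J) (A : I -> set T) :
  mutually_independent Pr E -> injective a -> (forall i, E (a i) (A i)) ->
  Pr (\bigcap_i A i) = (\prod_i Pr (A i))%E.
Proof.
move=> ind a_inj EA.
rewrite [RHS](reindex_onto (@enum_val I I) enum_rank)/=; last first.
  by move=> i _; exact: enum_rankK.
rewrite [RHS](eq_bigl xpredT); last by move=> i; rewrite enum_valK eqxx.
have := ind _ (fun i : 'I_#|I| => a (enum_val i)) (fun i => A (enum_val i)).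
move=> <- //; last by move=> i j /a_inj/enum_val_inj.
congr (Pr _); apply/seteqP; split => o /= h i _; first exact: h.
by rewrite -(enum_rankK i); exact: h.
Qed.

Section Histories.
Context (N d P Q B : nat).

(** A common finite codomain for all sources, so that a history is a plain finite function. *)
Definition outcome : finType :=
  (({set 'I_d} * {set 'I_d}) + {set 'I_N} + ({perm 'I_P} + 'I_(N %/ P)))%type.

Definition reading (a : source P Q B) (u : nat -> draw N d P Q B) : outcome :=
  match a with
  | Features t => inl (inl (feature_set (u t), coordinate_set (u t)))
  | Observations t => inl (inr (observation_set (u t)))
  | Assignment t q => inr (inl (assignment (u t) q))
  | Defs.Pick t p q i => inr (inr (Defs.pick (u t) p q i))
  end.

(** The sources of the first t iterations as a finite type; [source] itself is infinite. *)
Definition past (t : nat) : finType :=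
  ('I_t + 'I_t + ('I_t * 'I_Q + 'I_t * 'I_P * 'I_Q * 'I_B))%type.

Definition past_source t (i : past t) : source P Q B :=
  match i with
  | inl (inl r) => @Features P Q B r
  | inl (inr r) => @Observations P Q B r
  | inr (inl (r, q)) => @Assignment P Q B r q
  | inr (inr (r, p, q, i)) => @Defs.Pick P Q B r p q i
  end.

Lemma past_source_inj t : injective (@past_source t).
Proof.
case=> [[r|r]|[[r q]|[[[r p] q] i]]];
  case=> [[r'|r']|[[r' q']|[[[r' p'] q'] i']]] //=.
- by case=> /val_inj ->.
- by case=> /val_inj ->.
- by case=> /val_inj -> ->.
- by case=> /val_inj -> -> -> ->.
Qed.

Definition current_source t (i : bool) : source P Q B :=
  if i then @Features P Q B t else @Observations P Q B t.

(** Joins to the past the two sources at time t from which the gradient estimate is built. *)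
Definition past_or_current t (i : bool + past t) : source P Q B :=
  match i with inl i => current_source t i | inr i => past_source i end.

Lemma past_or_current_inj t : injective (@past_or_current t).
Proof.
have lt (r : 'I_t) : nat_of_ord r = t -> False.
  by move=> e; have := ltn_ord r; rewrite e ltnn.
case=> [[]|i]; case=> [[]|j] //=.
- by case: j => [[r|r]|[[r q]|[[[r p] q] k]]] //= [] /esym/lt.
- by case: j => [[r|r]|[[r q]|[[[r p] q] k]]] //= [] /esym/lt.
- by case: i => [[r|r]|[[r q]|[[[r p] q] k]]] //= [] /lt.
- by case: i => [[r|r]|[[r q]|[[[r p] q] k]]] //= [] /lt.
- by move=> /past_source_inj ->.
Qed.

Definition history t (u : nat -> draw N d P Q B) : {ffun past t -> outcome} :=
  [ffun i => reading (past_source i) u].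

Lemma history_eq t (u u' : nat -> draw N d P Q B) :
  history t u = history t u' -> forall r, (r < t)%N -> u r = u' r.
Proof.
move=> /ffunP h r rt.
have h1 := h (inl (inl (Ordinal rt))); have h2 := h (inl (inr (Ordinal rt))).
have h3 q := h (inr (inl (Ordinal rt, q))).
have h4 p q i := h (inr (inr (Ordinal rt, p, q, i))).
rewrite !ffunE/= in h1 h2.
have {}h3 : assignment (u r) = assignment (u' r).
  by apply/funext => q; have := h3 q; rewrite !ffunE/= => -[].
have {}h4 : Defs.pick (u r) = Defs.pick (u' r).
  apply/funext => p; apply/funext => q; apply/funext => i.
  by have := h4 p q i; rewrite !ffunE/= => -[].
move: h1 h2 h3 h4; case: (u r) => ? ? ? ? ?; case: (u' r) => ? ? ? ? ?/=.
by move=> [-> ->] [->] -> ->.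
Qed.

End Histories.

Section Sampling.
Context (R : realType) (disp : measure_display) (T : measurableType disp).
Context (Pr : probability T R) (N d P Q B : nat) (b c s : nat -> nat).
Context (U : nat -> T -> draw N d P Q B).
Hypothesis samp : sodda_sampling Pr b c s U.

Lemma reading_event (a : source P Q B) (A : set (outcome N d P)) :
  source_events U a ((fun o => reading a (U ^~ o)) @^-1` A).
Proof.
case: a => [t|t|t q|t p q i].
- by exists (fun v => A (inl (inl v))).
- by exists (fun v => A (inl (inr v))).
- by exists (fun v => A (inr (inl v))).
- by exists (fun v => A (inr (inr v))).
Qed.

(** Measurability with respect to the past, stated pathwise. By finiteness, adapted functions factor
    through [history t], hence are integrable. *)
Definition adapted t (A : Type) (phi : T -> A) : Prop :=
  forall o o', (forall r, (r < t)%N -> U r o = U r o') -> phi o = phi o'.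

Lemma history_eventE t h : (fun o => history t (U ^~ o)) @^-1` [set h] =
  \bigcap_i (fun o => reading (past_source i) (U ^~ o)) @^-1` [set h i].
Proof.
apply/seteqP; split => o /=.
  by move=> <- i _ /=; rewrite ffunE.
by move=> e; apply/ffunP => i; rewrite ffunE; exact: e.
Qed.

Lemma measurable_reading (a : source P Q B) (A : set (outcome N d P)) :
  measurable ((fun o => reading a (U ^~ o)) @^-1` A).
Proof. exact: (sampling_measurable samp (reading_event a A)). Qed.

Lemma measurable_history t h :
  measurable ((fun o => history t (U ^~ o)) @^-1` [set h]).
Proof.
rewrite history_eventE; apply: fin_bigcap_measurable => // i _.
exact: measurable_reading.
Qed.

Lemma adapted_history t (A : Type) (a0 : A) (phi : T -> A) : adapted t phi ->
  exists psi, phi = psi \o (fun o => history t (U ^~ o)).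
Proof.
by move=> ad; apply: factor_through => // o o' /history_eq; exact: ad.
Qed.

Lemma adaptedS t r (A : Type) (phi : T -> A) :
  (t <= r)%N -> adapted t phi -> adapted r phi.
Proof.
by move=> tr ad o o' e; apply: ad => k kt; apply: e; exact: leq_trans tr.
Qed.

Lemma adapted_integrable t (phi : T -> R) :
  adapted t phi -> Pr.-integrable setT (EFin \o phi).
Proof.
move=> /(adapted_history 0)[psi ->].
exact: finite_valued_integrable (@measurable_history t) _.
Qed.

Lemma adapted_le t (phi psi : T -> R) : adapted t phi -> adapted t psi ->
  {ae Pr, forall o, phi o <= psi o} ->
  \int[Pr]_o phi o <= \int[Pr]_o psi o.
Proof.
move=> /(adapted_history 0)[phi' ->] /(adapted_history 0)[psi' ->].
exact: (@finite_valued_le _ _ _ Pr _ _ (@measurable_history t) phi' psi').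
Qed.

Lemma adapted_measurable t (A : T -> Prop) :
  adapted t A -> measurable [set o | A o].
Proof.
move=> /(adapted_history False)[psi ->].
rewrite (_ : [set o | _] = \bigcup_(h in [set h | psi h])
  ((fun o => history t (U ^~ o)) @^-1` [set h])).
  apply: fin_bigcup_measurable => [|h _]; first exact: finite_finset.
  exact: measurable_history.
apply/seteqP; split => o /=; first by exists (history t (U ^~ o)).
by case=> h /= ph ->.
Qed.

Definition current_gradient_sources t (o : T) :
    {set 'I_d} * {set 'I_d} * {set 'I_N} :=
  (feature_set (U t o), coordinate_set (U t o), observation_set (U t o)).

Definition gradient_weight t (y : {set 'I_d} * {set 'I_d} * {set 'I_N}) : R :=
  uniform_weight [set S : {set 'I_d} | #|S| == b t]%SET y.1.1
  * uniform_weight (subsets_of y.1.1 (c t)) y.1.2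
  * uniform_weight [set D : {set 'I_N} | #|D| == s t]%SET y.2.

Lemma current_gradient_sources_eventE t y :
  current_gradient_sources t @^-1` [set y] =
  (fun o => reading (@Features P Q B t) (U ^~ o)) @^-1` [set inl (inl y.1)]
  `&` (fun o => reading (@Observations P Q B t) (U ^~ o))
      @^-1` [set inl (inr y.2)].
Proof.
case: y => [[S C] D]; apply/seteqP; split => o /=.
  by case=> -> -> ->.
by case=> -[e1 e2] -[e3]; rewrite /current_gradient_sources e1 e2 e3.
Qed.

(** Both events are intersections of events of distinct single sources. The product rule is used for
    all of them and for the past alone; the remaining factors are the prescribed laws, the
    coordinate set being drawn conditionally on the feature set. *)
Lemma history_independent t h y :
  Pr ((fun o => history t (U ^~ o)) @^-1` [set h]
      `&` current_gradient_sources t @^-1` [set y]) =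
  (Pr ((fun o => history t (U ^~ o)) @^-1` [set h])
   * (gradient_weight t y)%:E)%E.
Proof.
pose v (i : bool + past P Q B t) : outcome N d P := match i with
  | inl i => if i then inl (inl y.1) else inl (inr y.2) | inr i => h i end.
pose A i := (fun o => reading (past_or_current i) (U ^~ o)) @^-1` [set v i].
transitivity (Pr (\bigcap_i A i)).
  congr (Pr _); rewrite history_eventE current_gradient_sources_eventE.
  apply/seteqP; split => o.
    by move=> [h1 [h2 h3]] [[]|i] _ //; exact: h1.
  move=> e; split; first by move=> i _; exact: (e (inr i)).
  by split; [exact: (e (inl true))|exact: (e (inl false))].
have ind := sampling_independent samp.
rewrite (mutually_independent_finite ind (@past_or_current_inj P Q B t));
  last by move=> i; exact: reading_event.
rewrite big_sumType/= big_bool/= history_eventE.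
rewrite (mutually_independent_finite ind (@past_source_inj P Q B t));
  last by move=> i; exact: reading_event.
rewrite muleC; congr (_ * _)%E.
rewrite /gradient_weight EFinM; congr (_ * _)%E; last first.
  rewrite /A/= -(sampling_observations samp); congr (Pr _).
  by apply/seteqP; split => o /= => [[]|->].
rewrite EFinM /uniform_weight -(sampling_features samp).
rewrite -(sampling_coordinates samp); congr (Pr _).
by apply/seteqP; split => o; case: y @v @A => [[S C] D] /= [-> ->].
Qed.

Lemma adapted_independent t
    (Phi : T -> {set 'I_d} * {set 'I_d} * {set 'I_N} -> R) : adapted t Phi ->
  \int[Pr]_o Phi o (current_gradient_sources t o) =
  \int[Pr]_o \sum_y gradient_weight t y * Phi o y.
Proof.
move=> /(adapted_history (fun=> 0))[Psi ->].
have mY y : measurable (current_gradient_sources t @^-1` [set y]).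
  rewrite current_gradient_sources_eventE.
  by apply: measurableI; exact: measurable_reading.
exact: (@independent_mean _ _ _ Pr _ _ _ _ (@measurable_history t) mY
  _ (@history_independent t) Psi).
Qed.

End Sampling.

(** * Expected descent *)

(** Bounds the gradient estimate: the square root bounds every single-loss gradient at an iterate,
    and L M2 / 2 is the cost of masking. *)
Definition estimate_bound (R : realType) (N : nat) (L G M2 : R) : R :=
  N%:R * (Num.sqrt (N%:R * (G ^+ 2 + (L * M2) ^+ 2)) + L * (M2 / 2)).

(** The first summand comes from [mean_descent], the second from [risk_sodda_step]. The arguments
    exclude [d], [B], [gamma] and [xi], so the final constant can be fixed before them. *)
Definition descent_constant (R : realType) (N : nat) (L G M2 eta : R) : R :=
  let K := estimate_bound N L G M2 in
  ((L * M2) ^+ 2 + eta) / 2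
  + (L * M2 * L * expR 1 * K + L * (1 + expR 1) ^+ 2 * K ^+ 2).

Section Descent.
Context (R : realType) (disp : measure_display) (T : measurableType disp).
Context (Pr : probability T R) (N d P Q B : nat) (b c s : nat -> nat).
Context (U : nat -> T -> draw N d P Q B).
Context (x : 'I_N -> 'rV[R]_d) (f : 'I_N -> R -> R).
Context (obs : 'I_P * 'I_(N %/ P) -> 'I_N) (ws : 'cV[R]_d).
Context (L G M2 eta xi gamma : R).
Hypothesis samp : sodda_sampling Pr b c s U.
Hypothesis df : forall i z, derivable (f i) z 1.
Hypothesis lipL : forall i v v',
  enorm (gradient (loss (x i) (f i)) v - gradient (loss (x i) (f i)) v')
    <= L * enorm (v - v').
Hypothesis L0 : 0 < L.
Hypothesis N0 : (0 < N)%N.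
Hypothesis d0 : (0 < d)%N.
Hypothesis B0 : (0 < B)%N.
Hypothesis gamma0 : 0 < gamma.
Hypothesis small : B%:R * L * gamma <= 1.
Hypothesis dvd : (Q * P %| d)%N.
Hypothesis eta0 : 0 <= eta.
Hypothesis xi0 : 0 < xi.
Hypothesis sizes : forall t, (1 <= c t)%N /\ (c t <= b t)%N /\ (b t <= d)%N.
Hypothesis batch : forall t, (1 <= s t)%N /\ (s t <= N)%N.

Let F := risk x f.
Let w t o := sodda x f obs (fun=> gamma) s (U ^~ o) t.

Hypothesis minF : forall v, F ws <= F v.
Hypothesis convF : strongly_convex xi F.
Hypothesis variance : {ae Pr, forall o, forall t,
  (N%:R - 1)^-1 * \sum_(j < N)
    (enorm (gradient (loss (x j) (f j)) (w t o)) ^+ 2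
     - enorm (gradient F (w t o)) ^+ 2) <= G ^+ 2}.
Hypothesis bounded : {ae Pr, forall o, forall t, enorm (w t o) <= M2 / 2}.
Hypothesis bounded_min : enorm ws <= M2 / 2.
Hypothesis large_batch : forall t,
  L ^+ 2 * ((1 - (b t)%:R / d%:R) * (M2 / 2) ^+ 2)
    <= d%:R * eta * gamma ^+ 2 / (c t)%:R.

Local Notation K := (estimate_bound N L G M2).
Local Notation C := (descent_constant N L G M2 eta).

Lemma adapted_sodda t : adapted U t (w t).
Proof.
rewrite /w; elim: t => [|t IH] o o' e //=.
rewrite (IH o o'); last by move=> r rt; apply: e; exact: ltnW.
by rewrite e.
Qed.

Lemma gradient_risk_bound (v : 'cV[R]_d) :
  enorm v <= M2 / 2 -> enorm (gradient F v) <= L * M2.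
Proof.
move=> vM; apply: (le_trans (gradient_risk_le df lipL L0 v N0 minF)).
rewrite ler_pM2l//; apply: (le_trans (enorm_triangle _ _)).
by rewrite enormN (splitr M2) lerD.
Qed.

(** The variance bound controls the sum of all squared loss gradients, which dominates each term. *)
Lemma gradient_loss_bound (v : 'cV[R]_d) j :
  (N%:R - 1)^-1 * \sum_(j < N)
    (enorm (gradient (loss (x j) (f j)) v) ^+ 2 - enorm (gradient F v) ^+ 2)
    <= G ^+ 2 ->
  enorm (gradient F v) <= L * M2 ->
  enorm (gradient (loss (x j) (f j)) v)
    <= Num.sqrt (N%:R * (G ^+ 2 + (L * M2) ^+ 2)).
Proof.
move=> hG gF; set g := enorm (gradient F v) in hG gF *.
have g0 : 0 <= g by exact: enorm_ge0.
have g2 : g ^+ 2 <= (L * M2) ^+ 2.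
  by rewrite ler_pXn2r// nnegrE// (le_trans g0).
have G20 := sqr_ge0 G.
apply: enorm_le_sqr; first exact: sqrtr_ge0.
rewrite [Num.sqrt (_ * _) ^+ 2]sqr_sqrtr; last first.
  by rewrite mulr_ge0// addr_ge0// sqr_ge0.
(* For N = 1 the factor [(N%:R - 1)^-1] is the inverse of zero, that is 0, and the variance bound
   says nothing; the only loss is then the risk itself. *)
have [N1|N1] := leqP N 1.
  have N1' : N = 1%N by apply/eqP; rewrite eqn_leq N1 N0.
  have -> : gradient (loss (x j) (f j)) v = gradient F v.
    rewrite gradient_risk// (bigD1 j)//= big1 ?addr0 => [|i ij].
      by rewrite N1' invr1 scale1r.
    exfalso; move/eqP: ij; apply; apply: val_inj => /=.
    move: (leq_trans (ltn_ord i) N1) (leq_trans (ltn_ord j) N1).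
    by rewrite !ltnS !leqn0 => /eqP -> /eqP ->.
  rewrite -/g; have Nr : 1 <= N%:R :> R by rewrite ler1n.
  nra.
have N1p : 0 < N%:R - 1 :> R by rewrite subr_gt0 ltr1n.
move: hG; rewrite ler_pdivrMl// sumrB sumr_const card_ord => hG.
apply: (@le_trans _ _
  (\sum_(j < N) enorm (gradient (loss (x j) (f j)) v) ^+ 2)).
  by rewrite (bigD1 j)//= lerDl sumr_ge0// => i _; exact: sqr_ge0.
rewrite -mulr_natl in hG.
have Ng : N%:R * g ^+ 2 <= N%:R * (L * M2) ^+ 2 by rewrite ler_wpM2l.
lra.
Qed.

(** [mean_descent] followed by the Polyak-Lojasiewicz inequality, with c / d >= 1 / d and the
    squared gradient in the error bounded by (L M2)^2. *)
Lemma weighted_gradient_mean t (v : 'cV[R]_d) : enorm v <= M2 / 2 ->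
  2 * xi / d%:R * (F v - F ws) - gamma * (((L * M2) ^+ 2 + eta) / 2) <=
  \sum_y gradient_weight R b c s t y * dotv (gradient F v)
    (estimated_gradient x f (s t) y.1.1 y.1.2 y.2 v).
Proof.
move=> vM; have [c1 [cb bd]] := sizes t; have [s1 sN] := batch t.
have gF := gradient_risk_bound vM.
have g2 : enorm (gradient F v) ^+ 2 <= (L * M2) ^+ 2.
  by rewrite ler_pXn2r// nnegrE ?enorm_ge0// (le_trans _ gF)// enorm_ge0.
have cbt : (0 < c t <= b t)%N by rewrite c1.
have snt : (0 < s t <= N)%N by rewrite s1.
have := mean_descent df lipL L0 N0 cbt bd snt gamma0 (large_batch t) vM eta0.
rewrite !pair_bigA/= => /(le_trans _); apply.
have pl := polyak_lojasiewicz df lipL L0 ws v N0 xi0 convF.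
have dR : 0 < d%:R :> R by rewrite ltr0n.
have cR : 1 <= (c t)%:R :> R by rewrite ler1n.
have h1 : 2 * xi / d%:R * (F v - F ws)
    <= (c t)%:R / d%:R * enorm (gradient F v) ^+ 2.
  rewrite mulrAC [leRHS]mulrAC ler_pM2r ?invr_gt0//.
  by apply: (le_trans pl); rewrite ler_peMl// sqr_ge0.
have h2 := ler_wpM2l (ltW gamma0) g2.
rewrite -/F; lra.
Qed.

Lemma ae_risk_step t : {ae Pr, forall o,
  F (w t.+1 o) <= F (w t o)
    - gamma * B%:R * dotv (gradient F (w t o))
        (let y := current_gradient_sources U t o in
         estimated_gradient x f (s t) y.1.1 y.1.2 y.2 (w t o))
    + (L * M2 * L * expR 1 * K + L * (1 + expR 1) ^+ 2 * K ^+ 2)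
      * (gamma ^+ 2 * B%:R ^+ 2)}.
Proof.
move: variance bounded; apply: filterS2 => o hv hb.
have gF := gradient_risk_bound (hb t).
apply: risk_sodda_step => //.
have [s1 _] := batch t.
apply: (le_trans (enorm_estimated_gradient df lipL L0 N0 _ _ _ s1
  (fun j => gradient_loss_bound j (hv t) gF))).
rewrite /estimate_bound; apply: ler_wpM2l => //; rewrite lerD2l.
by apply: ler_wpM2l; [exact: ltW|exact: hb].
Qed.

(** The weight [A] plays the role of conditioning on the past: [A] = 1 gives the bound in
    expectation, an indicator the almost sure one. *)
Lemma expected_descent t (A : T -> R) : adapted U t A -> (forall o, 0 <= A o) ->
  \int[Pr]_o (A o * (F (w t.+1 o) - F ws)) <=
  \int[Pr]_o (A o * ((1 - 2 * xi * B%:R / d%:R * gamma) * (F (w t o) - F ws)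
    + C * (gamma ^+ 2 * B%:R ^+ 2))).
Proof.
move=> adA A0.
set K3 := L * M2 * L * expR 1 * K + L * (1 + expR 1) ^+ 2 * K ^+ 2.
pose phi o := A o * (F (w t o) - F ws + K3 * (gamma ^+ 2 * B%:R ^+ 2)).
pose Psi o (y : {set 'I_d} * {set 'I_d} * {set 'I_N}) :=
  A o * dotv (gradient F (w t o))
    (estimated_gradient x f (s t) y.1.1 y.1.2 y.2 (w t o)).
have adw := @adapted_sodda t.
have adphi : adapted U t phi.
  by move=> o o' e; rewrite /phi (adA _ _ e) (adw _ _ e).
have adPsi : adapted U t Psi.
  by move=> o o' e; rewrite /Psi (adA _ _ e) (adw _ _ e).
pose cur o := Psi o (current_gradient_sources U t o).
have adcur : adapted U t.+1 cur.
  move=> o o' e; rewrite /cur (adaptedS (leqnSn t) adPsi e).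
  by rewrite /current_gradient_sources e.
pose mean o := \sum_y gradient_weight R b c s t y * Psi o y.
have admean : adapted U t mean.
  move=> o o' e; rewrite /mean.
  by under eq_bigr => y _ do rewrite (adPsi _ _ e).
have adphi1 := adaptedS (leqnSn t) adphi.
have icur : Pr.-integrable setT (EFin \o (fun o => gamma * B%:R * cur o)).
  apply: (adapted_integrable samp (t := t.+1)) => o o' e.
  by rewrite (adcur _ _ e).
have imean : Pr.-integrable setT (EFin \o (fun o => gamma * B%:R * mean o)).
  apply: (adapted_integrable samp (t := t)) => o o' e.
  by rewrite (admean _ _ e).
have iphi := adapted_integrable samp adphi.
apply: (@le_trans _ _ (\int[Pr]_o (phi o - gamma * B%:R * cur o))).
  apply: (adapted_le samp (t := t.+1)).
  - move=> o o' e; rewrite (adapted_sodda e); congr (_ * _).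
    exact: (adaptedS (leqnSn t) adA).
  - by move=> o o' e; rewrite (adcur _ _ e) (adphi1 _ _ e).
  - have := ae_risk_step t; apply: filterS => o /= h.
    rewrite /phi /cur /Psi.
    have := ler_wpM2l (A0 o) h; rewrite -/K3; lra.
rewrite RintegralB// RintegralZl//; last exact: (adapted_integrable samp adcur).
have -> : \int[Pr]_o cur o = \int[Pr]_o mean o.
  exact: adapted_independent.
rewrite -RintegralZl//; last first.
  exact: (adapted_integrable samp admean).
rewrite -RintegralB//.
apply: (adapted_le samp (t := t)).
- by move=> o o' e; rewrite (admean _ _ e) (adphi _ _ e).
- by move=> o o' e; rewrite (adA _ _ e) (adw _ _ e).
move: bounded; apply: filterS => o hb.
have h := weighted_gradient_mean t (hb t).
rewrite (_ : mean o = A o * \sum_y gradient_weight R b c s t y *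
  dotv (gradient F (w t o))
    (estimated_gradient x f (s t) y.1.1 y.1.2 y.2 (w t o))); last first.
  by rewrite mulr_sumr; apply: eq_bigr => y _; rewrite /Psi; ring.
set E := \sum_y _ in h *; set Y := F (w t o) - F ws in h *.
rewrite /phi -/Y.
rewrite (_ : _ - _ = A o *
  (Y + K3 * (gamma ^+ 2 * B%:R ^+ 2) - gamma * B%:R * E)); last by ring.
apply: ler_wpM2l => //.
have gB : 0 <= gamma * B%:R by rewrite mulr_ge0// ltW.
have h1 := ler_wpM2l gB h.
have B1 : 1 <= B%:R :> R by rewrite ler1n.
(* As B >= 1, the first-order error, linear in B, is merged into the B^2 error of the step. *)
have hB : gamma ^+ 2 * B%:R * (((L * M2) ^+ 2 + eta) / 2) <=
    gamma ^+ 2 * B%:R ^+ 2 * (((L * M2) ^+ 2 + eta) / 2).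
  apply: ler_wpM2r; first by rewrite mulr_ge0// addr_ge0// sqr_ge0.
  by rewrite ler_wpM2l ?sqr_ge0// expr2 ler_peMl.
have -> : 2 * xi * B%:R / d%:R * gamma = gamma * B%:R * (2 * xi / d%:R) by ring.
rewrite /descent_constant -/K3; lra.
Qed.

Let Y t o := F (w t o) - F ws.
(** The one-step recursion is y -> (1 - kappa) y + rho, with fixed point rho / kappa. *)
Let kappa := 2 * xi * B%:R / d%:R * gamma.
Let rho := C * (gamma ^+ 2 * B%:R ^+ 2).

Let kappa0 : 0 < kappa.
Proof. 
have dR : 0 < d%:R :> R by rewrite ltr0n.
have BR : 0 < B%:R :> R by rewrite ltr0n.
by rewrite /kappa mulr_gt0// divr_gt0// mulr_gt0// mulr_gt0.
 Qed.

Let Y0 t o : 0 <= Y t o. Proof. by rewrite subr_ge0. Qed.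

Let adY t : adapted U t (Y t).
Proof. by move=> o o' e; rewrite /Y (adapted_sodda e). Qed.

Let intY t : Pr.-integrable setT (EFin \o Y t).
Proof. exact: (adapted_integrable samp (adY (t := t))). Qed.

Lemma descent_constant_ge0 : 0 <= C.
Proof.
have M20 : 0 <= M2 by have := le_trans (enorm_ge0 ws) bounded_min; lra.
have L1 := ltW L0; have e1 := ltW (@expR_gt0 R 1).
have K0 : 0 <= K.
  by rewrite mulr_ge0// addr_ge0 ?sqrtr_ge0// mulr_ge0// divr_ge0.
apply: addr_ge0; first by rewrite divr_ge0// addr_ge0// sqr_ge0.
have sq (z : R) : 0 <= z ^+ 2 := sqr_ge0 z.
by move: (K) K0 => k k0; apply: addr_ge0; rewrite !mulr_ge0.
Qed.

(** Iteration of the affine recursion; [kappa <= 1] allows multiplying the induction hypothesis by 1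
    - kappa. *)
Lemma expected_gap t : kappa <= 1 ->
  \int[Pr]_o Y t o <= (1 - kappa) ^+ t * (F 0 - F ws) + rho / kappa.
Proof.
move=> k1; have cstI (a : R) : \int[Pr]_o a = a.
  by rewrite Rintegral_cst// (congr1 fine (probability_setT Pr)) mulr1.
have rk : rho = kappa * (rho / kappa) by rewrite mulrC divfK// gt_eqF.
elim: t => [|t IH].
  rewrite expr0 mul1r /Y /w/= cstI lerDl divr_ge0 ?(ltW kappa0)//.
  by rewrite mulr_ge0 ?descent_constant_ge0// mulr_ge0 ?sqr_ge0.
have one : adapted U t (fun _ : T => 1 : R) by [].
have := expected_descent one (fun _ => ler01).
under eq_Rintegral do rewrite mul1r.
under [X in _ <= X -> _]eq_Rintegral do rewrite mul1r.
move=> /le_trans; apply.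
rewrite RintegralD//; last 2 first.
- by apply: (adapted_integrable samp (t := t)) => o o' e;
    rewrite (adapted_sodda e).
- by apply: (adapted_integrable samp (t := t)).
have -> : \int[Pr]_o ((1 - 2 * xi * B%:R / d%:R * gamma) * (F (w t o) - F ws))
    = (1 - kappa) * \int[Pr]_o Y t o by exact: RintegralZl (intY t).
rewrite cstI -/kappa -/rho exprS.
have := ler_wpM2l (_ : 0 <= 1 - kappa) IH.
rewrite subr_ge0 => /(_ k1).
set a := \int[Pr]_o _; set p := (1 - kappa) ^+ t; lra.
Qed.

Lemma recurrent_visit (e : R) m : 0 < e ->
  {ae Pr, forall o, exists2 r, (m <= r)%N & Y r o <= rho / kappa + e}.
Proof.
move=> e0; set a := rho / kappa.
(* These events decrease in t, and their intersection [Z] is the event that the gap never returns to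
   a + e from time m on. *)
pose S t := [set o | forall r, (m <= r <= m + t)%N -> a + e < Y r o].
have adS t : adapted U (m + t) (S t).
  move=> o o' eq; apply/propext; split => h r rt.
    by rewrite -(adY (o := o)) ?h// => k kr; apply: eq;
      apply: leq_trans kr _; case/andP: rt.
  by rewrite (adY (o' := o')) ?h// => k kr; apply: eq;
      apply: leq_trans kr _; case/andP: rt.
have mS t : measurable (S t) by exact: (adapted_measurable samp (@adS t)).
have adI t : adapted U (m + t) (\1_(S t) : T -> R).
  move=> o o' eq; rewrite !indicE; apply: (congr1 (fun i : bool => i%:R)).
  by apply/idP/idP; rewrite !inE (adS _ _ _ eq).
pose u t := \int[Pr]_o (\1_(S t) o * Y (m + t) o).
pose Z := \bigcap_t S t.
have mZ : measurable Z by exact: bigcapT_measurable.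
set delta := fine (Pr Z).
have dS t : delta <= \int[Pr]_o (\1_(S t) o).
  rewrite /Rintegral integral_indic// setIT fine_le ?fin_num_measure//.
  by rewrite le_measure ?inE// => o; exact.
have step t : u t.+1 <= u t - kappa * e * delta.
  (* Enlarging [S t.+1] to [S t] gives a weight adapted to time m + t, as [expected_descent]
     requires. *)
  apply: (@le_trans _ _ (\int[Pr]_o (\1_(S t) o * Y (m + t).+1 o))).
    have adI' : adapted U (m + t).+1 (\1_(S t.+1) : T -> R).
      by rewrite -addnS; exact: adI.
    rewrite /u addnS; apply: (adapted_le samp (t := (m + t).+1)).
    - by move=> o o' eq; rewrite (adY eq) (adI' _ _ eq).
    - by move=> o o' eq; rewrite (adY eq) (adaptedS (leqnSn _) (adI t) eq).
    apply: nearW => o; apply: ler_wpM2r => //.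
    rewrite !indicE; case: (boolP (o \in S t.+1)) => //; rewrite inE => h.
    rewrite mem_set// => r /andP[mr rt]; apply: h; rewrite mr addnS.
    exact: leqW.
  have I0 o : 0 <= \1_(S t) o :> R by rewrite indicE.
  have := expected_descent (adI t) I0.
  move=> /le_trans; apply.
  apply: (@le_trans _ _ (\int[Pr]_o (\1_(S t) o * Y (m + t) o
      - kappa * e * \1_(S t) o))).
    apply: (adapted_le samp (t := m + t)).
    - by move=> o o' eq; rewrite (adI _ _ _ eq) (adapted_sodda eq).
    - by move=> o o' eq; rewrite (adI _ _ _ eq) (adY eq).
    apply: nearW => o; rewrite -/(Y _ _) -/kappa -/rho indicE.
    case: (boolP (o \in S t)); rewrite ?mul0r ?mulr0 ?subr0// inE => h.
    (* On [S t], (1 - kappa) Y + rho = Y - kappa (Y - a) <= Y - kappa e. *)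
    have : a + e < Y (m + t) o by apply: h; rewrite leq_addr leqnn.
    have rk : rho = kappa * a by rewrite mulrC divfK// gt_eqF.
    by rewrite rk !mul1r mulr1 -(ltr_pM2l kappa0); lra.
  rewrite RintegralB//; last 2 first.
  - by apply: (adapted_integrable samp (t := m + t)) => o o' eq;
      rewrite (adI _ _ _ eq) (adY eq).
  - by apply: (adapted_integrable samp (t := m + t)) => o o' eq;
      rewrite (adI _ _ _ eq).
  rewrite RintegralZl//; last exact: (adapted_integrable samp (@adI t)).
  by rewrite lerD2l lerN2 ler_wpM2l// mulr_ge0// ltW.
have uu t : u t <= u 0%N - t%:R * (kappa * e * delta).
  elim: t => [|t IH]; first by rewrite mul0r subr0.
  by apply: (le_trans (step t)); rewrite -natr1; lra.
have u0 t : 0 <= u t.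
  by apply: Rintegral_ge0 => o _; apply: mulr_ge0; [rewrite indicE|exact: Y0].
have delta0 : delta = 0.
  apply/eqP; rewrite eq_le fine_ge0 ?measure_ge0// andbT leNgt.
  apply/negP => dp.
  have ked : 0 < kappa * e * delta by apply: mulr_gt0 => //; exact: mulr_gt0.
  (* After this many steps the accumulated decrease exceeds the initial value, so [u] would be
     negative. *)
  have := uu (Num.bound (u 0%N / (kappa * e * delta))).
  apply/negP; rewrite -ltNge; apply: lt_le_trans (u0 _).
  rewrite subr_lt0 -ltr_pdivrMr//.
  by apply: archi_boundP; rewrite divr_ge0// ltW.
exists Z; split => //.
  by rewrite -[Pr Z]fineK ?fin_num_measure// -/delta delta0.
move=> o /= no t _ r /andP[mr _]; rewrite ltNge; apply/negP => h.
by apply: no; exists r.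
Qed.

(** Countably many thresholds 1 / (n + 1) and times m share one null set; off it, every tail infimum
    is within any e > 0 of the limit. *)
Lemma liminf_gap : {ae Pr, forall o,
  (limn_einf (fun t => (F (w t o))%:E) - (F ws)%:E <= (rho / kappa)%:E)%E}.
Proof.
have : {ae Pr, forall o, forall n m, exists2 r, (m <= r)%N &
    Y r o <= rho / kappa + n.+1%:R^-1}.
  apply: ae_foralln => n; apply: ae_foralln => m.
  by apply: recurrent_visit; rewrite invr_gt0.
apply: filterS => o h; rewrite leeBlDr// limn_einf_lim.
apply: lime_le; first exact: is_cvg_einfs.
apply: nearW => m; apply/lee_addgt0Pr => e e0.
have [n ne] : exists n, n.+1%:R^-1 < e.
  have [n _ /(_ _ (leqnn n))] := near_infty_natSinv_lt (PosNum e0).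
  by exists n.
have [r mr hr] := h n m.
apply: (@le_trans _ _ (F (w r o))%:E).
  by apply: ereal_inf_lbound => /=; exists r.
rewrite -!EFinD lee_fin; move: hr; rewrite /Y lerBlDr => /le_trans; apply.
by rewrite addrAC lerD2l ltW.
Qed.

End Descent.

(** The hypothesis says d <= b (1 + q), whence 1 - b / d <= q, and L^2 q (M2 / 2)^2 is exactly the
    right-hand side. *)
Lemma batch_size_condition (R : realFieldType) (d b c L M2 eta gamma : R) :
  0 < d -> 0 < c -> 0 < L -> 0 <= eta -> 0 <= b <= d ->
  d / (1 + 4 * d * eta * gamma ^+ 2 / (c * M2 ^+ 2 * L ^+ 2)) <= b ->
  L ^+ 2 * ((1 - b / d) * (M2 / 2) ^+ 2) <= d * eta * gamma ^+ 2 / c.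
Proof.
move=> d0 c0 L0 eta0 /andP[b0 bd]; set q := _ / (c * _ * _) => h.
(* For M2 = 0 the quotient [q] divides by zero, but then the left-hand side vanishes. *)
have [M0|M0] := eqVneq M2 0.
  rewrite M0 mul0r expr0n !mulr0; apply: divr_ge0; last exact: ltW.
  by rewrite mulr_ge0 ?sqr_ge0// mulr_ge0// ltW.
have M2p : 0 < M2 ^+ 2 by rewrite lt_def sqrf_eq0 M0 sqr_ge0.
have L2p : 0 < L ^+ 2 by rewrite exprn_gt0.
have q0 : 0 <= q.
  have d1 := ltW d0; have c1 := ltW c0; have g2 := sqr_ge0 gamma.
  have M2p' := ltW M2p; have L2p' := ltW L2p.
  by rewrite /q; apply: divr_ge0; do ?apply: mulr_ge0 => //.
have h1 : d <= b * (1 + q) by rewrite -ler_pdivrMr// ltr_pwDl.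
have h2 : 1 - b / d <= q.
  rewrite -(ler_pM2l d0) mulrBr mulr1 mulrCA divff ?gt_eqF// mulr1.
  have := ler_wpM2r q0 bd; lra.
have -> : d * eta * gamma ^+ 2 / c = L ^+ 2 * (q * (M2 / 2) ^+ 2).
  by rewrite /q; field; rewrite M0 !gt_eqF.
by rewrite ler_pM2l// ler_wpM2r// sqr_ge0.
Qed.

Theorem theorem7 (R : realType) (N P Q : nat) (L G M2 eta : R) :
  (0 < N)%N -> (0 < P)%N -> (0 < Q)%N -> (P %| N)%N ->
  1 <= L -> 0 <= eta ->
  exists C4 : R, 0 < C4 /\
  forall (d B : nat) (x : 'I_N -> 'rV[R]_d) (f : 'I_N -> R -> R)
    (obs : 'I_P * 'I_(N %/ P) -> 'I_N) (ws : 'cV[R]_d) (xi gamma : R)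
    (b c s : nat -> nat)
    (disp : measure_display) (T : measurableType disp) (Pr : probability T R)
    (U : nat -> T -> draw N d P Q B),
  let F := risk x f in
  let w := fun (t : nat) (o : T) => sodda x f obs (fun=> gamma) s (U ^~ o) t in
  (0 < d)%N -> (Q * P %| d)%N -> (1 <= B)%N -> bijective obs ->
  (forall i z, derivable (f i) z 1) ->
  unique_minimizer F ws ->
  (forall t, (1 <= c t)%N /\ (c t <= b t)%N /\ (b t <= d)%N) ->
  (forall t, (1 <= s t)%N /\ (s t <= N)%N) ->
  sodda_sampling Pr b c s U ->
  0 < xi -> strongly_convex xi F ->
  (forall i v v',
    enorm (gradient (loss (x i) (f i)) v - gradient (loss (x i) (f i)) v')
      <= L * enorm (v - v')) ->
  {ae Pr, forall o, forall t,
    (N%:R - 1)^-1 * \sum_(j < N)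
      (enorm (gradient (loss (x j) (f j)) (w t o)) ^+ 2
       - enorm (gradient F (w t o)) ^+ 2) <= G ^+ 2} ->
  {ae Pr, forall o, forall t, enorm (w t o) <= M2 / 2} ->
  enorm ws <= M2 / 2 ->
  0 < gamma -> B%:R * L * gamma * Q%:R * P%:R <= 1 ->
  (forall t,
    Num.max (c t)%:R
      (d%:R / (1 + 4 * d%:R * eta * gamma ^+ 2
                   / ((c t)%:R * M2 ^+ 2 * L ^+ 2)))
      <= ((b t)%:R : R) <= d%:R) ->
  {ae Pr, forall o,
    (limn_einf (fun t => (F (w t o))%:E) - (F ws)%:E
      <= (C4 * d%:R * B%:R ^+ 3 * gamma / (2 * xi))%:E)%E} /\
  (gamma < Num.min (d%:R / (2 * xi * B%:R))
             (Num.min (1 / (B%:R * L * Q%:R * P%:R)) 1) ->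
   forall t,
    ('E_Pr[(fun o => (F (w t o) - F ws)%R)]
      <= ((1 - 2 * xi * B%:R / d%:R * gamma) ^+ t * (F 0 - F ws)
          + C4 * d%:R * B%:R ^+ 3 * gamma / (2 * xi))%:E)%E).
Proof.
move=> N0 P0 Q0 PN L1 eta0; pose C := descent_constant N L G M2 eta.
(* The absolute value and the added 1 make the witness positive. *)
exists (`|C| + 1); split; first by rewrite ltr_wpDl.
move=> d B x f obs ws xi gamma b c s disp T Pr U F w d0 dvd B0 _ df [minF _].
move=> sizes batch samp xi0 convF lipL hvar hbnd hws gamma0 hsmall hb.
have L0 : 0 < L := lt_le_trans ltr01 L1.
have dR : 0 < d%:R :> R by rewrite ltr0n.
have BR : 1 <= B%:R :> R by rewrite ler1n.
have BR0 : 0 < B%:R :> R by rewrite ltr0n.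
have small : B%:R * L * gamma <= 1.
  apply: le_trans hsmall; rewrite -[leRHS]mulrA ler_peMr//.
    by rewrite !mulr_ge0// ltW.
  by rewrite -natrM ler1n muln_gt0 Q0 P0.
have large t : L ^+ 2 * ((1 - (b t)%:R / d%:R) * (M2 / 2) ^+ 2)
    <= d%:R * eta * gamma ^+ 2 / (c t)%:R.
  have [ct _] := sizes t; have /andP[+ bd] := hb t.
  rewrite ge_max => /andP[_ h].
  by apply: batch_size_condition => //; rewrite ?ltr0n// ler0n.
(* The limit rho / kappa equals C d B gamma / (2 xi); B^2 >= 1 gives the stated cube. *)
have bound : C * (gamma ^+ 2 * B%:R ^+ 2) / (2 * xi * B%:R / d%:R * gamma)
    <= (`|C| + 1) * d%:R * B%:R ^+ 3 * gamma / (2 * xi).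
  have -> : C * (gamma ^+ 2 * B%:R ^+ 2) / (2 * xi * B%:R / d%:R * gamma)
    = C * (d%:R * B%:R * gamma / (2 * xi)) by field; rewrite !gt_eqF.
  have -> : (`|C| + 1) * d%:R * B%:R ^+ 3 * gamma / (2 * xi)
    = (`|C| + 1) * B%:R ^+ 2 * (d%:R * B%:R * gamma / (2 * xi)).
    by field; rewrite gt_eqF.
  apply: ler_wpM2r.
    by rewrite divr_ge0// !mulr_ge0// ltW.
  apply: (@le_trans _ _ (`|C| + 1)).
    by rewrite (le_trans (ler_norm C))// lerDl.
  by rewrite ler_peMr ?addr_ge0// exprn_ege1.
split.
  have := liminf_gap samp df lipL L0 N0 d0 B0 gamma0 small dvd eta0 xi0 sizes
    batch minF convF hvar hbnd hws large.
  by apply: filterS => o /le_trans; apply; rewrite lee_fin.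
rewrite lt_min => /andP[hg _] t.
have k1 : 2 * xi * B%:R / d%:R * gamma <= 1.
  move: hg; rewrite ltr_pdivlMr ?mulr_gt0// => /ltW hg.
  by rewrite mulrAC ler_pdivrMr// mul1r mulrC.
have h := expected_gap samp df lipL L0 N0 d0 B0 gamma0 small dvd eta0 xi0 sizes
    batch minF convF hvar hbnd hws large t k1.
have adY : adapted U t (fun o => F (w t o) - F ws).
  have adw : adapted U t (w t) by exact: adapted_sodda.
  by move=> o o' e; rewrite (adw _ _ e).
have iY := adapted_integrable samp adY.
rewrite unlock -(fineK (integrable_fin_num measurableT iY)) lee_fin.
by apply: (le_trans h); rewrite lerD2l.
Qed.
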